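(* Fix a sign and let $\alpha=\pm 3i$ (upper signs throughout for $\alpha=3i$, lower signs for $\alpha=-3i$). On a space with coordinates $(x,y,z,p,q)$, $y\neq0$, let $$E^1=\tfrac i2(y^2-1)\partial_y-\tfrac i2(2yp+1)\partial_p-iy\,\partial_z,\quad E^2=\tfrac12(y^2+1)\partial_y-\tfrac12(2yp+1)\partial_p-y\,\partial_z,\quad E^3=i(y\partial_y-p\partial_p-\partial_z),$$ consider the rolling distribution spanned by $$X^1=\partial_x-E^2,\qquad X^{2\pm}=i\partial_q-e^{\alpha x}E^1+\alpha e^{\alpha x}E^3 ,$$ and put $$X^3=i\frac{y^2-1}{2y}E^1+\frac{y^2+1}{2y}E^2+5iE^3 .$$ Then the Lie algebra of split $\mathfrak g_2$ is obtained from the pairwise bracket-generating set $\{S^1,S^2,S^3\}$, i.e. the following three vector fields pairwise bracket-generate the Lie algebra of split $\mathfrak g_2$: $$\begin{aligned} S^1&=\tfrac{1}{16y}e^{\frac z2}\Big(3q\,e^{\pm\frac{3ix}{2}}(y\pm i)(y^2\mp4iy-1)\pm i\,e^{\mp\frac{3ix}{2}}(y\mp i)(y^2\pm4iy-1)\Big)X^1\\ &\quad+\tfrac{i}{16y}e^{\frac z2}\Big(3q\,e^{\mp\frac{3ix}{2}}(y\mp i)(y^2\mp2iy-1)\pm i\,e^{\mp\frac{9ix}{2}}(y\pm i)(y^2\pm2iy-1)\Big)X^{2\pm},\\ S^2&=\tfrac{3}{16y}e^{\frac z2\pm\frac{3ix}{2}}(y^3\mp3iy^2+3y\mp i)X^1+\tfrac{3i}{16y}e^{\frac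 z2\mp\frac{3ix}{2}}(y^3\mp3iy^2-3y\pm i)X^{2\pm},\\ S^3&=\tfrac{2}{3y^2}e^{-z}\big(8y^2(y^2+1)p^2+4y(3y^2+1)p+5y^2+1\big)X^1\\ &\quad+i\,\tfrac{2}{3y^2}e^{-z\mp3ix}\big(8y^2(y^2-1)p^2+4y(3y^2-1)p+5y^2-1\big)X^{2\pm}+\tfrac{4(2yp+1)^2}{3y}e^{-z}X^3 . \end{aligned}$$
   Context: Here $i^2=-1$; vector fields have complex-valued analytic coefficients in $(x,y,z,p,q)$, and brackets are the usual Lie brackets extended complex-bilinearly. The distribution spanned by $X^1,X^{2\pm}$ is the common annihilator of $\omega_1=\sigma_1-ie^{\alpha x}dq$, $\omega_2=\sigma_2+dx$, $\omega_3=\sigma_3+i\alpha e^{\alpha x}dq$, where $\sigma_1=i(dy+y\,dz)-i(y^2-1)(dp-p\,dz)$, $\sigma_2=dy+y\,dz-(y^2+1)(dp-p\,dz)$, $\sigma_3=-2iy(dp-p\,dz)+i\,dz$, and $E^1,E^2,E^3$ are dual to $\sigma_1,\sigma_2,\sigma_3$. Definition (pairwise bracket-generation). Given vector fields $S^1,S^2,S^3$, set $$S^4=[S^1,S^2],\quad S^5=[S^2,S^3],\quad S^6=[S^3,S^1],$$ $$L^1=[S^1,S^4],\quad L^2=[S^2,S^4],\quad L^3=[S^2,S^5],\quad L^4=[S^3,S^5],\quad L^5=[S^3,S^6],\quad L^6=[S^1,S^6],$$ $$H=[S^2,S^6],\qquad h=[S^4,S^3].$$ One says that $\{S^1,S^2,S^3\}$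 pairwise bracket-generate the Lie algebra of split $\mathfrak g_2$ if the 14 vector fields $$S^1,\dots,S^6,\ \tfrac14(h-H),\ \tfrac{\sqrt3}{12}(h+H),\ L^1,\dots,L^6$$ form (a basis, over $\mathbb R$, of) the 14-dimensional Lie algebra of split $\mathfrak g_2$ (the split real form), with Cartan subalgebra spanned by $A=\frac14(h-H)$ and $B=\frac{\sqrt3}{12}(h+H)$, and with root diagram, with respect to this Cartan subalgebra, as follows (a vector field $V$ is a root vector with root $(a,b)$ if $[A,V]=aV$ and $[B,V]=bV$): short roots $S^1:(1,0)$, $S^5:(-1,0)$, $S^4:(\frac12,\frac{\sqrt3}2)$, $S^3:(-\frac12,-\frac{\sqrt3}2)$, $S^2:(-\frac12,\frac{\sqrt3}2)$, $S^6:(\frac12,-\frac{\sqrt3}2)$; long roots $L^1:(\frac32,\frac{\sqrt3}2)$, $L^4:(-\frac32,-\frac{\sqrt3}2)$, $L^2:(0,\sqrt3)$, $L^5:(0,-\sqrt3)$, $L^3:(-\frac32,\frac{\sqrt3}2)$, $L^6:(\frac32,-\frac{\sqrt3}2)$. *)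

(* Defs.v *)
From Stdlib Require Import Reals List.
From Coquelicot Require Import Coquelicot.
Import ListNotations.

Local Open Scope C_scope.

(** * Complex vector fields in the real coordinates (x, y, z, p, q), y <> 0 *)

Inductive coord := cx | cy | cz | cp | cq.

Definition coord_eq_dec (i j : coord) : {i = j} + {i <> j}.
Proof. decide equality. Defined.

Definition point := coord -> R.

Definition space (u : point) : Prop := u cy <> 0%R.

Definition update (u : point) (j : coord) (t : R) : point :=
  fun k => if coord_eq_dec j k then t else u k.

(** Partial derivative of a complex-valued function.  [Derive] is total and
    only meaningful where the derivative exists; the fields built below from
    [S1], [S2], [S3] are analytic on the open set [space]. *)
Definition pd (j : coord) (f : point -> C) (u : point) : C :=
  (Derive (fun t => Re (f (update u j t))) (u j),
   Derive (fun t => Im (f (update u j t))) (u j)).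

Definition sum_coord (F : coord -> C) : C := F cx + F cy + F cz + F cp + F cq.

(** Complexified tangent vectors, by their components. *)
Definition tv := coord -> C.

Definition tv_add (v w : tv) : tv := fun k => v k + w k.
Definition tv_scale (c : C) (v : tv) : tv := fun k => c * v k.
Definition partial (j : coord) : tv :=
  fun k => if coord_eq_dec j k then RtoC 1 else RtoC 0.

Declare Scope tv_scope.
Delimit Scope tv_scope with tv.
Bind Scope tv_scope with tv.
Notation "v + w" := (tv_add v w) : tv_scope.
Notation "v - w" := (tv_add v (tv_scale (Copp (RtoC 1)) w)) : tv_scope.
Notation "c ** v" := (tv_scale c%C v%tv) (at level 40, left associativity)
  : tv_scope.

Definition vf := point -> tv.

(** A vector field on [space] is a [vf] considered up to [vf_eq]: values
    outside [space] are irrelevant, and [bracket] respects [vf_eq] because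
    [space] is open. *)
Definition vf_eq (X Y : vf) : Prop := forall u, space u -> forall k, X u k = Y u k.

Definition vf_zero : vf := fun _ _ => RtoC 0.
Definition vf_add (X Y : vf) : vf := fun u => (X u + Y u)%tv.
Definition vf_sub (X Y : vf) : vf := fun u => (X u - Y u)%tv.
Definition vf_scale (r : R) (X : vf) : vf := fun u => (RtoC r ** X u)%tv.

Definition bracket (X Y : vf) : vf := fun u k =>
  sum_coord (fun j => X u j * pd j (fun v => Y v k) u
                      - Y u j * pd j (fun v => X v k) u).

(** * Real Lie algebras of vector fields *)

Inductive rspan (P : vf -> Prop) : vf -> Prop :=
| rspan_gen X : P X -> rspan P X
| rspan_zero : rspan P vf_zero
| rspan_add X Y : rspan P X -> rspan P Y -> rspan P (vf_add X Y)
| rspan_scale r X : rspan P X -> rspan P (vf_scale r X)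
| rspan_eq X Y : vf_eq X Y -> rspan P X -> rspan P Y.

Definition span_list (l : list vf) : vf -> Prop := rspan (fun X => In X l).

Fixpoint lincomb (c : nat -> R) (l : list vf) : vf :=
  match l with
  | [] => vf_zero
  | X :: l' => vf_add (vf_scale (c 0%nat) X) (lincomb (fun i => c (S i)) l')
  end.

Definition lin_indep (l : list vf) : Prop :=
  forall c, vf_eq (lincomb c l) vf_zero ->
  forall i, (i < length l)%nat -> c i = 0%R.

Definition bracket_closed (g : vf -> Prop) : Prop :=
  forall X Y, g X -> g Y -> g (bracket X Y).

Fixpoint lower_central (h : vf -> Prop) (n : nat) : vf -> Prop :=
  match n with
  | O => h
  | S n' => rspan (fun Z => exists X Y,
                     h X /\ lower_central h n' Y /\ Z = bracket X Y)
  end.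

Definition nilpotent (h : vf -> Prop) : Prop :=
  exists n, forall X, lower_central h n X -> vf_eq X vf_zero.

(** [h] and [g] are meant to be real subspaces, as given by [rspan]. *)
Definition cartan_subalgebra (h g : vf -> Prop) : Prop :=
  (forall X, h X -> g X) /\
  bracket_closed h /\
  nilpotent h /\
  (forall X, g X -> (forall Y, h Y -> h (bracket X Y)) -> h X).

Definition root_vector (A B V : vf) (a b : R) : Prop :=
  vf_eq (bracket A V) (vf_scale a V) /\ vf_eq (bracket B V) (vf_scale b V).

(** * Split g2, as the derivation algebra of the split octonions *)

Definition vec3 : Type := (R * R * R)%type.

Definition dot (u v : vec3) : R :=
  let '(u1, u2, u3) := u in let '(v1, v2, v3) := v in
  (u1 * v1 + u2 * v2 + u3 * v3)%R.

Definition cross (u v : vec3) : vec3 :=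
  let '(u1, u2, u3) := u in let '(v1, v2, v3) := v in
  (u2 * v3 - u3 * v2, u3 * v1 - u1 * v3, u1 * v2 - u2 * v1)%R.

(** Zorn's vector matrices: [(a, b, u, v)] stands for the matrix with diagonal
    entries [a], [b], upper right entry [u] and lower left entry [v]. *)
Definition oct : Type := (R * R * vec3 * vec3)%type.

Definition oct_mul (s t : oct) : oct :=
  let '(a, b, u, v) := s in
  let '(a', b', u', v') := t in
  ((a * a' + dot u v')%R,
   (b * b' + dot v u')%R,
   plus (plus (scal a u') (scal b' u)) (cross v v'),
   minus (plus (scal a' v) (scal b v')) (cross u u')).

Definition derivation (D : oct -> oct) : Prop :=
  (forall s t, D (plus s t) = plus (D s) (D t)) /\
  (forall (r : R) s, D (scal r s) = scal r (D s)) /\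
  (forall s t, D (oct_mul s t) = plus (oct_mul (D s) t) (oct_mul s (D t))).

Definition der_add (D D' : oct -> oct) : oct -> oct := fun s => plus (D s) (D' s).
Definition der_scale (r : R) (D : oct -> oct) : oct -> oct := fun s => scal r (D s).
Definition der_bracket (D D' : oct -> oct) : oct -> oct :=
  fun s => minus (D (D' s)) (D' (D s)).

Definition isomorphic_to_split_g2 (g : vf -> Prop) : Prop :=
  exists Phi : (oct -> oct) -> vf,
    (forall D, derivation D -> g (Phi D)) /\
    (forall D D', derivation D -> derivation D' ->
       vf_eq (Phi (der_add D D')) (vf_add (Phi D) (Phi D'))) /\
    (forall r D, derivation D ->
       vf_eq (Phi (der_scale r D)) (vf_scale r (Phi D))) /\
    (forall D D', derivation D -> derivation D' ->
       vf_eq (Phi (der_bracket D D')) (bracket (Phi D) (Phi D'))) /\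
    (forall D, derivation D -> vf_eq (Phi D) vf_zero -> forall s, D s = zero) /\
    (forall X, g X -> exists D, derivation D /\ vf_eq (Phi D) X).

(** * Pairwise bracket-generation *)

Definition pairwise_bracket_generate (S1 S2 S3 : vf) : Prop :=
  let S4 := bracket S1 S2 in
  let S5 := bracket S2 S3 in
  let S6 := bracket S3 S1 in
  let L1 := bracket S1 S4 in
  let L2 := bracket S2 S4 in
  let L3 := bracket S2 S5 in
  let L4 := bracket S3 S5 in
  let L5 := bracket S3 S6 in
  let L6 := bracket S1 S6 in
  let H := bracket S2 S6 in
  let h := bracket S4 S3 in
  let A := vf_scale (1 / 4) (vf_sub h H) in
  let B := vf_scale (sqrt 3 / 12) (vf_add h H) in
  let basis := [S1; S2; S3; S4; S5; S6; A; B; L1; L2; L3; L4; L5; L6] in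
  let g := span_list basis in
  lin_indep basis /\
  bracket_closed g /\
  isomorphic_to_split_g2 g /\
  cartan_subalgebra (span_list [A; B]) g /\
  (root_vector A B S1 1 0 /\
   root_vector A B S5 (-1) 0 /\
   root_vector A B S4 (1 / 2) (sqrt 3 / 2) /\
   root_vector A B S3 (- 1 / 2) (- sqrt 3 / 2) /\
   root_vector A B S2 (- 1 / 2) (sqrt 3 / 2) /\
   root_vector A B S6 (1 / 2) (- sqrt 3 / 2)) /\
  (root_vector A B L1 (3 / 2) (sqrt 3 / 2) /\
   root_vector A B L4 (- 3 / 2) (- sqrt 3 / 2) /\
   root_vector A B L2 0 (sqrt 3) /\
   root_vector A B L5 0 (- sqrt 3) /\
   root_vector A B L3 (- 3 / 2) (sqrt 3 / 2) /\
   root_vector A B L6 (3 / 2) (- sqrt 3 / 2)).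

(** * The rolling distribution and the three generators *)

Definition cexp (c : C) : C := ((exp (Re c) * cos (Im c))%R, (exp (Re c) * sin (Im c))%R).

Definition Ef1 : vf := fun u =>
  let y : C := u cy in let p : C := u cp in
  (Ci / 2 * (y ^ 2 - 1) ** partial cy
   - Ci / 2 * (2 * y * p + 1) ** partial cp
   - Ci * y ** partial cz)%tv.

Definition Ef2 : vf := fun u =>
  let y : C := u cy in let p : C := u cp in
  (1 / 2 * (y ^ 2 + 1) ** partial cy
   - 1 / 2 * (2 * y * p + 1) ** partial cp
   - y ** partial cz)%tv.

Definition Ef3 : vf := fun u =>
  let y : C := u cy in let p : C := u cp in
  (Ci ** (y ** partial cy - p ** partial cp - partial cz))%tv.

Definition X1 : vf := fun u => (partial cx - Ef2 u)%tv.

Definition X2 (alpha : C) : vf := fun u =>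
  let x : C := u cx in
  (Ci ** partial cq - cexp (alpha * x) ** Ef1 u
   + alpha * cexp (alpha * x) ** Ef3 u)%tv.

Definition X3 : vf := fun u =>
  let y : C := u cy in
  (Ci * ((y ^ 2 - 1) / (2 * y)) ** Ef1 u
   + (y ^ 2 + 1) / (2 * y) ** Ef2 u
   + 5 * Ci ** Ef3 u)%tv.

(** In [S1], [S2], [S3], [si] is [i] for the upper signs and [-i] for the lower
    signs. *)
Definition S1 (si alpha : C) : vf := fun u =>
  let x : C := u cx in let y : C := u cy in let z : C := u cz in
  let q : C := u cq in
  (1 / (16 * y) * cexp (z / 2)
     * (3 * q * cexp (3 * si * x / 2) * (y + si) * (y ^ 2 - 4 * si * y - 1)
        + si * cexp (- (3 * si * x / 2)) * (y - si) * (y ^ 2 + 4 * si * y - 1))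
   ** X1 u
   + Ci / (16 * y) * cexp (z / 2)
     * (3 * q * cexp (- (3 * si * x / 2)) * (y - si) * (y ^ 2 - 2 * si * y - 1)
        + si * cexp (- (9 * si * x / 2)) * (y + si) * (y ^ 2 + 2 * si * y - 1))
   ** X2 alpha u)%tv.

Definition S2 (si alpha : C) : vf := fun u =>
  let x : C := u cx in let y : C := u cy in let z : C := u cz in
  (3 / (16 * y) * cexp (z / 2 + 3 * si * x / 2)
     * (y ^ 3 - 3 * si * y ^ 2 + 3 * y - si)
   ** X1 u
   + 3 * Ci / (16 * y) * cexp (z / 2 - 3 * si * x / 2)
     * (y ^ 3 - 3 * si * y ^ 2 - 3 * y + si)
   ** X2 alpha u)%tv.

Definition S3 (si alpha : C) : vf := fun u =>
  let x : C := u cx in let y : C := u cy in let z : C := u cz in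
  let p : C := u cp in
  (2 / (3 * y ^ 2) * cexp (- z)
     * (8 * y ^ 2 * (y ^ 2 + 1) * p ^ 2 + 4 * y * (3 * y ^ 2 + 1) * p
        + 5 * y ^ 2 + 1)
   ** X1 u
   + Ci * (2 / (3 * y ^ 2)) * cexp (- z - 3 * si * x)
     * (8 * y ^ 2 * (y ^ 2 - 1) * p ^ 2 + 4 * y * (3 * y ^ 2 - 1) * p
        + 5 * y ^ 2 - 1)
   ** X2 alpha u
   + 4 * (2 * y * p + 1) ^ 2 / (3 * y) * cexp (- z)
   ** X3 u)%tv.

(* Main.v *)
Require Import Defs.
From Stdlib Require Import ZArith Reals QArith Qreals Lra Lia.
From Coquelicot Require Import Coquelicot.
From Stdlib Require Import List.
Import ListNotations.

(** The fields S1, S2, S3 have coefficients that are polynomials in y, 1/y, p, q and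
    exponentials e^(i x / 2), e^(z / 2) and their inverses, with Gaussian rational
    coefficients.  This ring is closed under products and partial derivatives, so
    all iterated brackets can be computed exactly once it is known that the formal
    bracket represents the analytic one ([lbracket_val]).  In the basis
    S1, ..., S6, h, H, L1, ..., L6 the brackets close up with integer structure
    constants, the same for both signs ([generators_structure]).  Evaluation at two
    points shows that the fourteen fields are linearly independent over R
    ([generated_independent]).

    What remains concerns only a fourteen-dimensional real Lie algebra with a known
    table.  A derivation of Zorn's vector matrices is given by two vectors m and n
    of R^3 and a traceless matrix T ([derivation_classification]).  Sending
    S1, S2, S3 to the derivations with m = e_1, e_2, e_3 determines the images of all
    iterated brackets, and the commutators of these derivations satisfy the table
    found for the vector fields ([derivation_coord_bracket]).  So the real span is
    isomorphic to the derivation algebra of the split octonions.  The elements A and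
    B act diagonally with the stated roots; as these are all nonzero, the span of A
    and B is its own normaliser, hence a Cartan subalgebra ([spanned_cartan]). *)

Local Open Scope C_scope.

(** * Partial derivatives and brackets *)

Definition has_pd (j : coord) (f : point -> C) (u : point) (l : C) : Prop :=
  is_derive (fun t => Re (f (update u j t))) (u j) (Re l) /\
  is_derive (fun t => Im (f (update u j t))) (u j) (Im l).

Lemma has_pd_unique j f u l : has_pd j f u l -> pd j f u = l.
Proof.
  intros [Hr%is_derive_unique Hi%is_derive_unique].
  destruct l. now apply (f_equal2 pair).
Qed.

Lemma has_pd_const j c u : has_pd j (fun _ => c) u (RtoC 0).
Proof. split; apply is_derive_Reals, derivable_pt_lim_const. Qed.

Lemma has_pd_plus j f g u l m :
  has_pd j f u l -> has_pd j g u m -> has_pd j (fun v => f v + g v) u (l + m).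
Proof.
  intros [Fr Fi] [Gr Gi].
  split; [apply (is_derive_plus _ _ _ _ _ Fr Gr)
         | apply (is_derive_plus _ _ _ _ _ Fi Gi)].
Qed.

Lemma has_pd_scale j (c : C) f u l :
  has_pd j f u l -> has_pd j (fun v => c * f v) u (c * l).
Proof.
  intros [Fr Fi].
  split.
  - apply (is_derive_minus _ _ _ _ _
      (is_derive_scal _ _ (Re c) _ Fr) (is_derive_scal _ _ (Im c) _ Fi)).
  - apply (is_derive_plus _ _ _ _ _
      (is_derive_scal _ _ (Re c) _ Fi) (is_derive_scal _ _ (Im c) _ Fr)).
Qed.

Lemma space_update_locally u j :
  space u -> locally (u j) (fun t => space (update u j t)).
Proof.
  intros Hu.
  destruct (coord_eq_dec j cy) as [-> | Hj].
  - apply (open_neq 0%R). exact Hu.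
  - apply filter_forall; intros t. unfold space, update.
    destruct (coord_eq_dec j cy); tauto.
Qed.

(** [space] is open along every coordinate line, so a partial derivative at one of
    its points only sees values on [space]. *)
Lemma pd_ext j f g u :
  space u -> (forall v, space v -> f v = g v) -> pd j f u = pd j g u.
Proof.
  intros Hu Hfg. unfold pd.
  f_equal; apply Derive_ext_loc;
    (eapply filter_imp; [| apply (space_update_locally u j Hu)]);
    intros t Ht; simpl; now rewrite (Hfg _ Ht).
Qed.

Lemma vf_eq_refl X : vf_eq X X.
Proof. easy. Qed.

Lemma vf_eq_sym X Y : vf_eq X Y -> vf_eq Y X.
Proof. intros E u Hu k; symmetry; now apply E. Qed.

Lemma vf_eq_trans X Y Z : vf_eq X Y -> vf_eq Y Z -> vf_eq X Z.
Proof. intros E F u Hu k. rewrite E by exact Hu. now apply F. Qed.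

(** This makes [bracket] an operation on vector fields considered on [space]: any
    field may be replaced by a computable representative. *)
Lemma bracket_ext X X' Y Y' :
  vf_eq X X' -> vf_eq Y Y' -> vf_eq (bracket X Y) (bracket X' Y').
Proof.
  intros EX EY u Hu k. unfold bracket, sum_coord.
  now rewrite !EX, !EY,
    !(fun j => pd_ext j _ (fun v => Y' v k) u Hu (fun v Hv => EY v Hv k)),
    !(fun j => pd_ext j _ (fun v => X' v k) u Hu (fun v Hv => EX v Hv k)).
Qed.

Lemma bracket_antisym X Y : vf_eq (bracket X Y) (vf_scale (-1) (bracket Y X)).
Proof.
  intros u _ k. unfold bracket, sum_coord, vf_scale, tv_scale. ring.
Qed.

(** * Real linear combinations of vector fields *)

(** The recursion shifts the index as [lincomb] does, so that sums of coefficients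
    and combinations of fields are unfolded by the same induction. *)
Fixpoint rsum (n : nat) (f : nat -> R) : R :=
  match n with
  | O => 0%R
  | S n' => (f 0%nat + rsum n' (fun i => f (S i)))%R
  end.

Lemma lincomb_ext c d l :
  (forall i, (i < length l)%nat -> c i = d i) -> lincomb c l = lincomb d l.
Proof.
  revert c d; induction l as [| X l IH]; intros c d E; [reflexivity |].
  simpl. rewrite (E 0%nat) by (simpl; lia). f_equal. apply IH.
  intros i Hi. apply E. simpl; lia.
Qed.

Lemma vf_eq_lincomb c d l :
  (forall i, (i < length l)%nat -> c i = d i) -> vf_eq (lincomb c l) (lincomb d l).
Proof. intros E. rewrite (lincomb_ext c d l E). apply vf_eq_refl. Qed.

Lemma lincomb_Forall2 c l l' :
  Forall2 vf_eq l l' -> vf_eq (lincomb c l) (lincomb c l').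
Proof.
  intros E; revert c; induction E as [| X Y l l' EX _ IH]; intros c u Hu k; [easy |].
  simpl. unfold vf_add, vf_scale, tv_add, tv_scale. now rewrite EX, IH.
Qed.

Lemma nth_Forall2 i l l' :
  Forall2 vf_eq l l' -> vf_eq (nth i l vf_zero) (nth i l' vf_zero).
Proof.
  intros E; revert i; induction E as [| X Y l l' EX _ IH]; intros [| i]; simpl; easy.
Qed.

Lemma lincomb_add c d l u k :
  lincomb (fun i => (c i + d i)%R) l u k = lincomb c l u k + lincomb d l u k.
Proof.
  revert c d; induction l as [| X l IH]; intros c d.
  - simpl. unfold vf_zero. ring.
  - simpl. unfold vf_add, vf_scale, tv_add, tv_scale.
    rewrite (IH (fun i => c (S i))), RtoC_plus. ring.
Qed.

Lemma lincomb_scale r c l u k :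
  lincomb (fun i => (r * c i)%R) l u k = RtoC r * lincomb c l u k.
Proof.
  revert c; induction l as [| X l IH]; intros c.
  - simpl. unfold vf_zero. ring.
  - simpl. unfold vf_add, vf_scale, tv_add, tv_scale.
    rewrite (IH (fun i => c (S i))), RtoC_mult. ring.
Qed.

Lemma lincomb_zero l u k : lincomb (fun _ => 0%R) l u k = RtoC 0.
Proof.
  induction l as [| X l IH]; [reflexivity |].
  simpl. unfold vf_add, vf_scale, tv_add, tv_scale. rewrite IH. ring.
Qed.

(** Coefficient matrices multiply when combinations are substituted into one
    another; this turns bilinearity of the bracket into a formula for coefficients. *)
Lemma lincomb_lincomb l l' (M : nat -> nat -> R) c u k :
  (forall i, (i < length l')%nat -> nth i l' vf_zero u k = lincomb (M i) l u k) ->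
  lincomb c l' u k = lincomb (fun n => rsum (length l') (fun i => c i * M i n)%R) l u k.
Proof.
  revert M c; induction l' as [| X l' IH]; intros M c E.
  - simpl. now rewrite lincomb_zero.
  - simpl. rewrite lincomb_add, lincomb_scale, <- (E 0%nat) by (simpl; lia).
    rewrite <- (IH (fun i => M (S i)) (fun i => c (S i))); [reflexivity |].
    intros i Hi. apply (E (S i)). simpl; lia.
Qed.

Definition unit_vector (i n : nat) : R := if Nat.eqb n i then 1%R else 0%R.

Lemma lincomb_unit l i u k :
  (i < length l)%nat -> lincomb (unit_vector i) l u k = nth i l vf_zero u k.
Proof.
  revert i; induction l as [| X l IH]; intros i Hi; [simpl in Hi; lia |].
  simpl. unfold vf_add, vf_scale, tv_add, tv_scale.
  destruct i as [| i]; simpl.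
  - change (fun i => unit_vector 0 (S i)) with (fun _ : nat => 0%R).
    rewrite lincomb_zero. unfold unit_vector; simpl. ring.
  - change (fun n => unit_vector (S i) (S n)) with (unit_vector i).
    rewrite IH by (simpl in Hi; lia). unfold unit_vector; simpl. ring.
Qed.

Lemma rspan_lincomb (P : vf -> Prop) c l :
  (forall X, In X l -> rspan P X) -> rspan P (lincomb c l).
Proof.
  revert c; induction l as [| X l IH]; intros c Hl; [apply rspan_zero |].
  simpl. apply rspan_add; [apply rspan_scale, Hl; now left |].
  apply IH. intros Y HY. apply Hl. now right.
Qed.

(** A real span is the image of the coefficient vectors, on which the structure
    constants act. *)
Lemma span_list_lincomb l X : span_list l X <-> exists c, vf_eq X (lincomb c l).
Proof.
  split.
  - induction 1 as [X HX | | X Y _ [c Ec] _ [d Ed] | r X _ [c Ec] | X Y E _ [c Ec]].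
    + destruct (In_nth _ _ vf_zero HX) as [i [Hi <-]].
      exists (unit_vector i). intros u _ k. now rewrite lincomb_unit.
    + exists (fun _ => 0%R). intros u _ k. now rewrite lincomb_zero.
    + exists (fun i => c i + d i)%R. intros u Hu k.
      rewrite lincomb_add, <- Ec, <- Ed by exact Hu. reflexivity.
    + exists (fun i => r * c i)%R. intros u Hu k.
      rewrite lincomb_scale, <- Ec by exact Hu. reflexivity.
    + exists c. exact (vf_eq_trans _ _ _ (vf_eq_sym _ _ E) Ec).
  - intros [c Ec]. apply (rspan_eq _ _ _ (vf_eq_sym _ _ Ec)).
    apply rspan_lincomb. intros Y HY. now apply rspan_gen.
Qed.

Lemma lin_indep_inj l c d :
  lin_indep l -> vf_eq (lincomb c l) (lincomb d l) ->
  forall i, (i < length l)%nat -> c i = d i.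
Proof.
  intros Hi E i Hl. apply Rminus_diag_uniq.
  apply (Hi (fun i => c i + -1 * d i)%R) in Hl; [lra |].
  intros u Hu k. rewrite lincomb_add, lincomb_scale, (E u Hu k).
  unfold vf_zero. change (-1)%R with (- (1))%R. rewrite RtoC_opp. ring.
Qed.

Definition smooth (X : vf) : Prop :=
  forall u, space u -> forall j k, exists l, has_pd j (fun v => X v k) u l.

Lemma lincomb_smooth c l : Forall smooth l -> smooth (lincomb c l).
Proof.
  intros Hl; revert c.
  induction Hl as [| X l HX Hl IH]; intros c u Hu j k.
  - exists (RtoC 0). exact (has_pd_const j (RtoC 0) u).
  - destruct (HX u Hu j k) as [a Ha].
    destruct (IH (fun i => c (S i)) u Hu j k) as [b Hb].
    exists (RtoC (c 0%nat) * a + b).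
    apply (has_pd_plus j (fun v => RtoC (c 0%nat) * X v k)); [| exact Hb].
    apply (has_pd_scale j _ (fun v => X v k)). exact Ha.
Qed.

(** Smoothness is what lets the partial derivatives, which are total functions,
    distribute over the sum. *)
Lemma bracket_lincomb_r X c l :
  Forall smooth l ->
  vf_eq (bracket X (lincomb c l)) (lincomb c (map (bracket X) l)).
Proof.
  intros Hl; revert c.
  induction Hl as [| Y l HY Hl IH]; intros c u Hu k.
  - simpl. unfold bracket, sum_coord, vf_zero.
    rewrite !(fun j => has_pd_unique j _ u _ (has_pd_const j (RtoC 0) u)). ring.
  - simpl. unfold vf_add at 2, tv_add. rewrite <- (IH _ u Hu k).
    assert (E : forall j, pd j (fun v => vf_add (vf_scale (c 0%nat) Y)
                                 (lincomb (fun i => c (S i)) l) v k) u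
                = RtoC (c 0%nat) * pd j (fun v => Y v k) u
                  + pd j (fun v => lincomb (fun i => c (S i)) l v k) u).
    { intros j.
      destruct (HY u Hu j k) as [a Ha].
      destruct (lincomb_smooth (fun i => c (S i)) l Hl u Hu j k) as [b Hb].
      rewrite (has_pd_unique _ _ _ _ Ha), (has_pd_unique _ _ _ _ Hb).
      apply has_pd_unique.
      apply (has_pd_plus j (fun v => RtoC (c 0%nat) * Y v k)); [| exact Hb].
      apply (has_pd_scale j _ (fun v => Y v k)). exact Ha. }
    unfold bracket at 1, sum_coord. rewrite !E.
    unfold bracket, sum_coord, vf_add, vf_scale, tv_add, tv_scale. ring.
Qed.

Lemma bracket_lincomb_l c l X :
  Forall smooth l ->
  vf_eq (bracket (lincomb c l) X) (lincomb c (map (fun Y => bracket Y X) l)).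
Proof.
  intros Hl u Hu k.
  rewrite bracket_antisym by exact Hu. unfold vf_scale, tv_scale.
  rewrite bracket_lincomb_r by assumption. clear Hl.
  revert c; induction l as [| Y l IH]; intros c; simpl.
  - unfold vf_zero. ring.
  - unfold vf_add, vf_scale, tv_add, tv_scale. rewrite <- IH.
    rewrite (bracket_antisym Y X u Hu k). unfold vf_scale, tv_scale.
    change (-1)%R with (- (1))%R. rewrite RtoC_opp. ring.
Qed.

Lemma nth_map_vf (f : vf -> vf) l i :
  (i < length l)%nat -> nth i (map f l) vf_zero = f (nth i l vf_zero).
Proof.
  intros Hi. rewrite (nth_indep _ _ (f vf_zero)) by now rewrite length_map.
  apply map_nth.
Qed.

(** * Laurent polynomials *)

(** [Mono a b c d e] stands for e^(i a x / 2) y^b e^(c z / 2) p^d q^e.  The half-integer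
    frequencies are those that occur in the generators.  Only y is invertible on
    [space], hence natural exponents for p and q. *)
Inductive mono := Mono (a b c : Z) (d e : nat).

Definition mono_abs (m : mono) (u : point) : R :=
  let '(Mono a b c d e) := m in
  (exp (IZR c / 2 * u cz) * powerRZ (u cy) b * u cp ^ d * u cq ^ e)%R.

Definition mono_arg (m : mono) (u : point) : R :=
  let '(Mono a _ _ _ _) := m in (IZR a / 2 * u cx)%R.

Definition mono_val (m : mono) (u : point) : C :=
  ((mono_abs m u * cos (mono_arg m u))%R, (mono_abs m u * sin (mono_arg m u))%R).

Definition mono_mul (m n : mono) : mono :=
  let '(Mono a b c d e) := m in
  let '(Mono a' b' c' d' e') := n in
  Mono (a + a') (b + b') (c + c') (d + d') (e + e').

Lemma mono_val_mul m n u :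
  space u -> mono_val (mono_mul m n) u = mono_val m u * mono_val n u.
Proof.
  destruct m as [a b c d e], n as [a' b' c' d' e']. intros Hu.
  unfold mono_val, mono_arg, mono_abs, mono_mul, Cmult; cbn [fst snd].
  rewrite !plus_IZR, !pow_add, (powerRZ_add _ _ _ Hu).
  replace ((IZR c + IZR c') / 2 * u cz)%R
    with (IZR c / 2 * u cz + IZR c' / 2 * u cz)%R by field.
  replace ((IZR a + IZR a') / 2 * u cx)%R
    with (IZR a / 2 * u cx + IZR a' / 2 * u cx)%R by field.
  rewrite exp_plus, cos_plus, sin_plus.
  f_equal; ring.
Qed.

Definition mono_compare (m n : mono) : comparison :=
  let '(Mono a b c d e) := m in
  let '(Mono a' b' c' d' e') := n in
  match Z.compare a a' with
  | Eq => match Z.compare b b' with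
          | Eq => match Z.compare c c' with
                  | Eq => match Nat.compare d d' with
                          | Eq => Nat.compare e e'
                          | r => r
                          end
                  | r => r
                  end
          | r => r
          end
  | r => r
  end.

Lemma mono_compare_eq m n : mono_compare m n = Eq -> m = n.
Proof.
  destruct m as [a b c d e], n as [a' b' c' d' e']; simpl.
  destruct (Z.compare_spec a a'); try discriminate.
  destruct (Z.compare_spec b b'); try discriminate.
  destruct (Z.compare_spec c c'); try discriminate.
  destruct (Nat.compare_spec d d'); try discriminate.
  destruct (Nat.compare_spec e e'); try discriminate.
  now subst.
Qed.

(** Gaussian rationals a + b i. *)
Definition gauss : Type := (Q * Q)%type.

Definition gval (g : gauss) : C := (Q2R (fst g), Q2R (snd g)).

Definition gadd (g h : gauss) : gauss :=
  (Qred (fst g + fst h), Qred (snd g + snd h))%Q.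

Definition gmul (g h : gauss) : gauss :=
  (Qred (fst g * fst h - snd g * snd h), Qred (fst g * snd h + snd g * fst h))%Q.

Definition g_is_zero (g : gauss) : bool :=
  Z.eqb (Qnum (fst g)) 0 && Z.eqb (Qnum (snd g)) 0.

Lemma Q2R_Qred q : Q2R (Qred q) = Q2R q.
Proof. apply Qeq_eqR, Qred_correct. Qed.

Lemma gval_add g h : gval (gadd g h) = gval g + gval h.
Proof. unfold gval, gadd, Cplus; cbn [fst snd]. now rewrite !Q2R_Qred, !Q2R_plus. Qed.

Lemma gval_mul g h : gval (gmul g h) = gval g * gval h.
Proof.
  unfold gval, gmul, Cmult; cbn [fst snd].
  rewrite !Q2R_Qred, Q2R_minus, Q2R_plus, !Q2R_mult. f_equal; ring.
Qed.

Lemma gval_is_zero g : g_is_zero g = true -> gval g = RtoC 0.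
Proof.
  destruct g as [[a b] [c d]]; unfold g_is_zero, gval, Q2R; simpl.
  intros [->%Z.eqb_eq ->%Z.eqb_eq]%andb_prop.
  now rewrite !Rmult_0_l.
Qed.

Definition laurent := list (mono * gauss).

Fixpoint lval (P : laurent) (u : point) : C :=
  match P with
  | [] => RtoC 0
  | (m, g) :: P' => gval g * mono_val m u + lval P' u
  end.

(** Null terms are dropped on construction: a zero polynomial must compute to the
    empty list, and differentiation may put a null term out of order. *)
Definition lcons (m : mono) (g : gauss) (P : laurent) : laurent :=
  if g_is_zero g then P else (m, g) :: P.

(** Merges lists that are increasing for [mono_compare].  In sorted lists equal
    monomials meet and cancel, so that an identity between Laurent polynomials is
    recognised by its difference being the empty list. *)
Fixpoint ladd (P : laurent) : laurent -> laurent :=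
  match P with
  | [] => fun R => R
  | (m, g) :: P' =>
      fix ladd_aux (R : laurent) : laurent :=
        match R with
        | [] => P
        | (n, h) :: R' =>
            match mono_compare m n with
            | Lt => (m, g) :: ladd P' R
            | Gt => (n, h) :: ladd_aux R'
            | Eq => lcons m (gadd g h) (ladd P' R')
            end
        end
  end.

Definition lscale (m : mono) (g : gauss) (P : laurent) : laurent :=
  map (fun '(n, h) => (mono_mul m n, gmul g h)) P.

Fixpoint lmul (P R : laurent) : laurent :=
  match P with
  | [] => []
  | (m, g) :: P' => ladd (lscale m g R) (lmul P' R)
  end.

Lemma lval_cons m g P u : lval (lcons m g P) u = gval g * mono_val m u + lval P u.
Proof.
  unfold lcons. destruct (g_is_zero g) eqn:E; [| reflexivity].
  rewrite (gval_is_zero _ E). ring.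
Qed.

Lemma lval_add P R u : lval (ladd P R) u = lval P u + lval R u.
Proof.
  revert R; induction P as [| [m g] P IH]; intros R; [simpl; ring |].
  induction R as [| [n h] R IHR]; [simpl; ring |].
  simpl. simpl in IHR.
  destruct (mono_compare m n) eqn:E.
  - apply mono_compare_eq in E; subst n.
    rewrite lval_cons, gval_add, IH. ring.
  - simpl. rewrite IH. simpl. ring.
  - simpl. rewrite IHR. ring.
Qed.

Lemma lval_scale m g P u :
  space u -> lval (lscale m g P) u = gval g * mono_val m u * lval P u.
Proof.
  intros Hu. induction P as [| [n h] P IH]; simpl; [ring |].
  fold (lscale m g P). rewrite IH, gval_mul, (mono_val_mul _ _ _ Hu). ring.
Qed.

Lemma lval_mul P R u : space u -> lval (lmul P R) u = lval P u * lval R u.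
Proof.
  intros Hu. induction P as [| [m g] P IH]; simpl; [ring |].
  rewrite lval_add, (lval_scale _ _ _ _ Hu), IH. ring.
Qed.

(** For p and q the predecessor is truncated at 0, where the factor d or e in front
    vanishes. *)
Definition mono_deriv (j : coord) (m : mono) : gauss * mono :=
  let '(Mono a b c d e) := m in
  match j with
  | cx => ((0, a # 2), m)
  | cy => ((inject_Z b, 0), Mono a (b - 1) c d e)
  | cz => ((c # 2, 0), m)
  | cp => ((inject_Z (Z.of_nat d), 0), Mono a b c (pred d) e)
  | cq => ((inject_Z (Z.of_nat e), 0), Mono a b c d (pred e))
  end%Q.

Lemma is_derive_powerRZ (b : Z) (y : R) :
  y <> 0%R -> is_derive (fun t => powerRZ t b) y (IZR b * powerRZ y (b - 1))%R.
Proof.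
  intros Hy.
  assert (Hn : forall n : nat,
    (powerRZ y (Z.of_nat n - 1) * y = y ^ n)%R).
  { intros n. rewrite pow_powerRZ. rewrite <- (powerRZ_1 y) at 2.
    rewrite <- powerRZ_add by exact Hy. f_equal; lia. }
  destruct (Z_le_gt_dec 0 b) as [Hb | Hb].
  - destruct (Z_of_nat_complete b Hb) as [n ->].
    apply (is_derive_ext (fun t => t ^ n)%R).
    { intros t. now rewrite <- pow_powerRZ. }
    auto_derive; [easy |]. rewrite <- INR_IZR_INZ.
    destruct n as [| n]; [simpl; ring |].
    replace (Z.of_nat (S n) - 1)%Z with (Z.of_nat n) by lia.
    rewrite <- pow_powerRZ. simpl pred. ring.
  - destruct (Z_of_nat_complete (- b)) as [n Hn']; [lia |].
    assert (n <> 0%nat) by lia.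
    replace b with (- Z.of_nat n)%Z by lia.
    apply (is_derive_ext_loc (fun t => / t ^ n)%R).
    { eapply filter_imp; [| apply (open_neq 0%R); exact Hy].
      intros t Ht. now rewrite powerRZ_neg', <- pow_powerRZ. }
    auto_derive; [now apply pow_nonzero |].
    replace (- Z.of_nat n - 1)%Z with (- Z.of_nat (S n))%Z by lia.
    rewrite powerRZ_neg', <- pow_powerRZ, opp_IZR, <- INR_IZR_INZ.
    destruct n as [| n]; [easy |]. simpl pred.
    simpl pow. field. split; [now apply pow_nonzero | exact Hy].
Qed.

Lemma has_pd_mono j m u :
  space u ->
  has_pd j (mono_val m) u
    (gval (fst (mono_deriv j m)) * mono_val (snd (mono_deriv j m)) u).
Proof.
  destruct m as [a b c d e]. intros Hu.
  pose proof (is_derive_powerRZ b (u cy) Hu) as Hy.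
  assert (Q0 : Q2R 0 = 0%R) by apply RMicromega.Q2R_0.
  assert (QZ : forall n, Q2R (inject_Z n) = IZR n).
  { intros n. unfold Q2R; simpl. field. }
  assert (Q2 : forall n, Q2R (n # 2) = (IZR n / 2)%R) by reflexivity.
  set (g := fun t => powerRZ t b) in Hy.
  assert (Dy : Derive (fun t : R => g t) (u cy) = (IZR b * powerRZ (u cy) (b - 1))%R)
    by exact (is_derive_unique _ _ _ Hy).
  unfold has_pd, gval, mono_val, mono_abs, mono_arg, Cmult, Re, Im.
  destruct j; cbn [mono_deriv fst snd]; rewrite ?Q0, ?QZ, ?Q2;
    unfold update; simpl coord_eq_dec; cbn match;
    change (powerRZ ?t b) with (g t).
  all: split; auto_derive; try easy; try (eexists; exact Hy);
    rewrite ?Dy, <- ?INR_IZR_INZ; ring.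
Qed.

Fixpoint lderiv (j : coord) (P : laurent) : laurent :=
  match P with
  | [] => []
  | (m, g) :: P' =>
      let '(h, n) := mono_deriv j m in lcons n (gmul g h) (lderiv j P')
  end.

Lemma has_pd_laurent j P u :
  space u -> has_pd j (lval P) u (lval (lderiv j P) u).
Proof.
  intros Hu. induction P as [| [m g] P IH]; simpl.
  - exact (has_pd_const j (RtoC 0) u).
  - pose proof (has_pd_scale j (gval g) _ _ _ (has_pd_mono j m u Hu)) as Hm.
    destruct (mono_deriv j m) as [h n]; cbn [fst snd] in Hm.
    rewrite lval_cons, gval_mul, <- Cmult_assoc.
    exact (has_pd_plus j _ _ u _ _ Hm IH).
Qed.

Definition lconst (g : gauss) : laurent := lcons (Mono 0 0 0 0 0) g [].

Definition lopp (P : laurent) : laurent := lmul (lconst (- (1), 0)%Q) P.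

Lemma lval_const g u : lval (lconst g) u = gval g.
Proof.
  unfold lconst. rewrite lval_cons. unfold mono_val, mono_abs, mono_arg; simpl.
  replace (0 / 2 * u cx)%R with 0%R by field.
  replace (0 / 2 * u cz)%R with 0%R by field.
  rewrite cos_0, sin_0, exp_0.
  apply injective_projections; simpl; ring.
Qed.

Lemma gval_real q : gval (q, 0%Q) = RtoC (Q2R q).
Proof. unfold gval, RtoC; cbn [fst snd]. now rewrite RMicromega.Q2R_0. Qed.

Lemma gval_imag q : gval (0%Q, q) = Ci * RtoC (Q2R q).
Proof.
  unfold gval, RtoC, Ci, Cmult; cbn [fst snd]. rewrite RMicromega.Q2R_0.
  f_equal; ring.
Qed.

Lemma lval_opp P u : space u -> lval (lopp P) u = - lval P u.
Proof.
  intros Hu. unfold lopp. rewrite (lval_mul _ _ _ Hu), lval_const, gval_real.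
  replace (Q2R (- (1))) with (-1)%R by (unfold Q2R; simpl; lra).
  change (-1)%R with (- (1))%R. rewrite RtoC_opp. ring.
Qed.

(** * Vector fields with Laurent polynomial coefficients *)

Record lfield := LField
  { at_x : laurent; at_y : laurent; at_z : laurent; at_p : laurent; at_q : laurent }.

Definition component (F : lfield) (k : coord) : laurent :=
  match k with
  | cx => at_x F | cy => at_y F | cz => at_z F | cp => at_p F | cq => at_q F
  end.

Definition tabulate (f : coord -> laurent) : lfield :=
  LField (f cx) (f cy) (f cz) (f cp) (f cq).

Definition lfield_val (F : lfield) : vf := fun u k => lval (component F k) u.

Lemma component_tabulate f k : component (tabulate f) k = f k.
Proof. now destruct k. Qed.

Definition lbracket (F G : lfield) : lfield :=
  tabulate (fun k =>
    let term j := ladd (lmul (component F j) (lderiv j (component G k)))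
                       (lopp (lmul (component G j) (lderiv j (component F k)))) in
    ladd (ladd (ladd (ladd (term cx) (term cy)) (term cz)) (term cp)) (term cq)).

Lemma lfield_smooth F : smooth (lfield_val F).
Proof. intros u Hu j k. eexists. exact (has_pd_laurent j _ u Hu). Qed.

(** Laurent polynomials are closed under products and partial derivatives, so the
    bracket of two Laurent fields can be computed by list manipulations. *)
Lemma lbracket_val F G :
  vf_eq (bracket (lfield_val F) (lfield_val G)) (lfield_val (lbracket F G)).
Proof.
  intros u Hu k. unfold lfield_val, lbracket, bracket, sum_coord.
  rewrite component_tabulate, !lval_add, !lval_opp, !lval_mul by exact Hu.
  rewrite !(fun j P => has_pd_unique j (fun v => lval P v) u _ (has_pd_laurent j P u Hu)).
  ring.
Qed.

Definition lfield_add (F G : lfield) : lfield :=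
  tabulate (fun k => ladd (component F k) (component G k)).

Definition lfield_scale (P : laurent) (F : lfield) : lfield :=
  tabulate (fun k => lmul P (component F k)).

Definition rat (q : Q) : laurent := lconst (q, 0%Q).

Definition lpartial (j : coord) : lfield :=
  tabulate (fun k => if coord_eq_dec j k then lconst (1, 0)%Q else []).

Definition lfield_zero : lfield := tabulate (fun _ => []).

Fixpoint llincomb (c : nat -> Z) (l : list lfield) : lfield :=
  match l with
  | [] => lfield_zero
  | F :: l' =>
      lfield_add (lfield_scale (rat (inject_Z (c O))) F) (llincomb (fun i => c (S i)) l')
  end.

Definition lfield_is_zero (F : lfield) : bool :=
  forallb (fun k => match component F k with [] => true | _ => false end)
    [cx; cy; cz; cp; cq].

Lemma Q2R_1 : Q2R 1 = 1%R.
Proof. exact RMicromega.Q2R_1. Qed.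

Lemma Q2R_inject_Z n : Q2R (inject_Z n) = IZR n.
Proof. unfold Q2R; simpl; field. Qed.

Lemma lval_rat q u : lval (rat q) u = RtoC (Q2R q).
Proof. unfold rat. now rewrite lval_const, gval_real. Qed.

Lemma lfield_add_val F G u k :
  lfield_val (lfield_add F G) u k = tv_add (lfield_val F u) (lfield_val G u) k.
Proof. unfold lfield_val, lfield_add. now rewrite component_tabulate, lval_add. Qed.

Lemma lfield_scale_val P F u k :
  space u -> lfield_val (lfield_scale P F) u k = tv_scale (lval P u) (lfield_val F u) k.
Proof. intros Hu. unfold lfield_val, lfield_scale. now rewrite component_tabulate, lval_mul. Qed.

Lemma lpartial_val j u k : lfield_val (lpartial j) u k = partial j k.
Proof.
  unfold lfield_val, lpartial, partial. rewrite component_tabulate.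
  destruct (coord_eq_dec j k); [| reflexivity].
  now rewrite lval_const, gval_real, Q2R_1.
Qed.

Lemma llincomb_val c l u k :
  space u ->
  lfield_val (llincomb c l) u k = lincomb (fun i => IZR (c i)) (map lfield_val l) u k.
Proof.
  intros Hu. revert c; induction l as [| F l IH]; intros c.
  - simpl. unfold lfield_val, lfield_zero. now rewrite component_tabulate.
  - simpl. rewrite lfield_add_val. unfold vf_add, vf_scale, tv_add.
    rewrite lfield_scale_val, (IH _) by exact Hu. unfold tv_scale.
    now rewrite lval_rat, Q2R_inject_Z.
Qed.

Lemma lfield_is_zero_val F u k : lfield_is_zero F = true -> lfield_val F u k = RtoC 0.
Proof.
  unfold lfield_is_zero. rewrite forallb_forall. intros E. unfold lfield_val.
  assert (In k [cx; cy; cz; cp; cq]) as H by (destruct k; simpl; tauto).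
  specialize (E k H). now destruct (component F k).
Qed.

Definition represents (X : vf) (F : lfield) : Prop := vf_eq X (lfield_val F).

Lemma represents_add X Y F G :
  represents X F -> represents Y G ->
  represents (fun u => tv_add (X u) (Y u)) (lfield_add F G).
Proof. intros EF EG u Hu k. rewrite lfield_add_val. unfold tv_add. now rewrite EF, EG. Qed.

Lemma represents_scale f P X F :
  (forall u, space u -> f u = lval P u) -> represents X F ->
  represents (fun u => tv_scale (f u) (X u)) (lfield_scale P F).
Proof.
  intros EP EF u Hu k. rewrite lfield_scale_val by exact Hu. unfold tv_scale.
  now rewrite EF, EP.
Qed.

Lemma represents_sub X Y F G :
  represents X F -> represents Y G ->
  represents (fun u => tv_add (X u) (tv_scale (- (RtoC 1)) (Y u)))
    (lfield_add F (lfield_scale (rat (- (1))) G)).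
Proof.
  intros EF EG. apply represents_add; [exact EF |].
  apply (represents_scale (fun _ => - (RtoC 1))); [| exact EG].
  intros u _. rewrite lval_rat, <- RtoC_opp. f_equal. unfold Q2R; simpl; lra.
Qed.

Lemma represents_partial j : represents (fun _ => partial j) (lpartial j).
Proof. intros u _ k. now rewrite lpartial_val. Qed.

(** * The generators as Laurent fields *)

Declare Scope laurent_scope.
Delimit Scope laurent_scope with laurent.
Bind Scope laurent_scope with laurent.
Infix "+" := ladd : laurent_scope.
Infix "*" := lmul : laurent_scope.
Notation "P - R" := (ladd P (lopp R)) : laurent_scope.

Definition imag : laurent := lconst (0, 1)%Q.

Definition var_y : laurent := [(Mono 0 1 0 0 0, (1, 0)%Q)].

Definition var_y_inv : laurent := [(Mono 0 (-1) 0 0 0, (1, 0)%Q)].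

Definition var_p : laurent := [(Mono 0 0 0 1 0, (1, 0)%Q)].

Definition var_q : laurent := [(Mono 0 0 0 0 1, (1, 0)%Q)].

Definition exp_zx (c a : Z) : laurent := [(Mono a 0 c 0 0, (1, 0)%Q)].

Fixpoint lpow (P : laurent) (n : nat) : laurent :=
  match n with O => rat 1 | S n' => lmul P (lpow P n') end.

Infix "^" := lpow : laurent_scope.

Declare Scope lfield_scope.
Delimit Scope lfield_scope with lfield.
Bind Scope lfield_scope with lfield.
Infix "+" := lfield_add : lfield_scope.
Notation "P ** F" := (lfield_scale P%laurent F%lfield)
  (at level 40, left associativity) : lfield_scope.
Notation "F - G" := (lfield_add F (lfield_scale (rat (- (1))) G)) : lfield_scope.

Definition lE1 : lfield :=
  (imag * rat (1 # 2) * (var_y ^ 2 - rat 1) ** lpartial cy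
   - imag * rat (1 # 2) * (rat 2 * var_y * var_p + rat 1) ** lpartial cp
   - imag * var_y ** lpartial cz)%lfield.

Definition lE2 : lfield :=
  (rat (1 # 2) * (var_y ^ 2 + rat 1) ** lpartial cy
   - rat (1 # 2) * (rat 2 * var_y * var_p + rat 1) ** lpartial cp
   - var_y ** lpartial cz)%lfield.

Definition lE3 : lfield :=
  (imag ** (var_y ** lpartial cy - var_p ** lpartial cp - rat 1 ** lpartial cz))%lfield.

Definition lX1 : lfield := (lpartial cx - lE2)%lfield.

(** Here alpha = 3 i s, so that e^(alpha x) is the monomial with a = 6 s. *)
Definition lX2 (s : Z) : lfield :=
  let al := (rat (3 * inject_Z s) * imag)%laurent in
  (imag ** lpartial cq - exp_zx 0 (6 * s) ** lE1 + al * exp_zx 0 (6 * s) ** lE3)%lfield.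

Definition lX3 : lfield :=
  (imag * ((var_y ^ 2 - rat 1) * rat (1 # 2) * var_y_inv) ** lE1
   + (var_y ^ 2 + rat 1) * rat (1 # 2) * var_y_inv ** lE2
   + rat 5 * imag ** lE3)%lfield.

Definition sign_i (s : Z) : laurent := (rat (inject_Z s) * imag)%laurent.

Definition lS1 (s : Z) : lfield :=
  let y := var_y in let si := sign_i s in
  (rat (1 # 16) * var_y_inv * exp_zx 1 0
     * (rat 3 * var_q * exp_zx 0 (3 * s) * (y + si) * (y ^ 2 - rat 4 * si * y - rat 1)
        + si * exp_zx 0 (- (3 * s)) * (y - si) * (y ^ 2 + rat 4 * si * y - rat 1))
   ** lX1
   + imag * (rat (1 # 16) * var_y_inv) * exp_zx 1 0
     * (rat 3 * var_q * exp_zx 0 (- (3 * s)) * (y - si) * (y ^ 2 - rat 2 * si * y - rat 1)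
        + si * exp_zx 0 (- (9 * s)) * (y + si) * (y ^ 2 + rat 2 * si * y - rat 1))
   ** lX2 s)%lfield.

Definition lS2 (s : Z) : lfield :=
  let y := var_y in let si := sign_i s in
  (rat (3 # 16) * var_y_inv * exp_zx 1 (3 * s)
     * (y ^ 3 - rat 3 * si * y ^ 2 + rat 3 * y - si)
   ** lX1
   + imag * (rat (3 # 16) * var_y_inv) * exp_zx 1 (- (3 * s))
     * (y ^ 3 - rat 3 * si * y ^ 2 - rat 3 * y + si)
   ** lX2 s)%lfield.

Definition lS3 (s : Z) : lfield :=
  let y := var_y in let p := var_p in
  (rat (2 # 3) * var_y_inv ^ 2 * exp_zx (- 2) 0
     * (rat 8 * y ^ 2 * (y ^ 2 + rat 1) * p ^ 2 + rat 4 * y * (rat 3 * y ^ 2 + rat 1) * p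
        + rat 5 * y ^ 2 + rat 1)
   ** lX1
   + imag * (rat (2 # 3) * var_y_inv ^ 2) * exp_zx (- 2) (- (6 * s))
     * (rat 8 * y ^ 2 * (y ^ 2 - rat 1) * p ^ 2 + rat 4 * y * (rat 3 * y ^ 2 - rat 1) * p
        + rat 5 * y ^ 2 - rat 1)
   ** lX2 s
   + rat (4 # 3) * (rat 2 * y * p + rat 1) ^ 2 * var_y_inv * exp_zx (- 2) 0
   ** lX3)%lfield.

Lemma lval_imag u : lval imag u = Ci.
Proof.
  unfold imag. rewrite lval_const, gval_imag. unfold Q2R; simpl.
  rewrite Rinv_1, Rmult_1_r. ring.
Qed.

Lemma lval_pow P n u : space u -> lval (lpow P n) u = lval P u ^ n.
Proof.
  intros Hu. induction n as [| n IH]; simpl lpow.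
  - rewrite lval_rat. unfold Q2R; simpl. now rewrite Rinv_1, Rmult_1_r.
  - now rewrite (lval_mul _ _ _ Hu), IH.
Qed.

Lemma lval_mono m u : lval [(m, (1, 0)%Q)] u = mono_val m u.
Proof. simpl. rewrite gval_real. unfold Q2R; simpl. rewrite Rinv_1, Rmult_1_r. ring. Qed.

Lemma mono_val_real b d e u :
  mono_val (Mono 0 b 0 d e) u = RtoC (powerRZ (u cy) b * u cp ^ d * u cq ^ e).
Proof.
  unfold mono_val, mono_abs, mono_arg, RtoC.
  replace (0 / 2 * u cx)%R with 0%R by field.
  replace (0 / 2 * u cz)%R with 0%R by field.
  rewrite cos_0, sin_0, exp_0. f_equal; ring.
Qed.

Lemma lval_y u : lval var_y u = RtoC (u cy).
Proof. unfold var_y. rewrite lval_mono, mono_val_real. f_equal; simpl; ring. Qed.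

Lemma lval_p u : lval var_p u = RtoC (u cp).
Proof. unfold var_p. rewrite lval_mono, mono_val_real. f_equal; simpl; ring. Qed.

Lemma lval_q u : lval var_q u = RtoC (u cq).
Proof. unfold var_q. rewrite lval_mono, mono_val_real. f_equal; simpl; ring. Qed.

Lemma lval_y_inv u : space u -> lval var_y_inv u = / RtoC (u cy).
Proof.
  intros Hu. unfold var_y_inv. rewrite lval_mono, mono_val_real.
  rewrite <- RtoC_inv by exact Hu. f_equal; simpl. field. exact Hu.
Qed.

Lemma lval_exp c a u :
  lval (exp_zx c a) u = cexp (RtoC (IZR c / 2 * u cz) + Ci * RtoC (IZR a / 2 * u cx)).
Proof.
  unfold exp_zx. rewrite lval_mono. unfold mono_val, mono_abs, mono_arg, cexp.
  simpl. f_equal; (f_equal; [ring_simplify; f_equal; ring | f_equal; ring]).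
Qed.

Lemma RtoC_y_neq u : space u -> RtoC (u cy) <> 0.
Proof. intros Hu E. apply Hu. now apply RtoC_inj. Qed.

Lemma Q2R_make n d : Q2R (n # d) = (IZR n / IZR (Zpos d))%R.
Proof. reflexivity. Qed.

#[local] Hint Rewrite lval_add lval_rat lval_imag lval_y lval_p lval_q
  Q2R_make Q2R_inject_Z Q2R_mult RtoC_div RtoC_mult : lval.

#[local] Hint Rewrite lval_opp lval_mul lval_pow lval_y_inv using assumption : lval.

(** Reduces the equality of a coefficient with its Laurent counterpart to a field
    identity in the coordinates. *)
Ltac coefficient :=
  intros u Hu; pose proof (RtoC_y_neq u Hu); autorewrite with lval; try field; auto.

Lemma Ef1_represented : represents Ef1 lE1.
Proof.
  apply represents_sub; [apply represents_sub |]; apply represents_scale;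
    try apply represents_partial; coefficient.
Qed.

Lemma Ef2_represented : represents Ef2 lE2.
Proof.
  apply represents_sub; [apply represents_sub |]; apply represents_scale;
    try apply represents_partial; coefficient.
Qed.

Lemma Ef3_represented : represents Ef3 lE3.
Proof.
  apply represents_scale; [coefficient | apply represents_sub; [apply represents_sub |]].
  - apply represents_scale; [coefficient | apply represents_partial].
  - apply represents_scale; [coefficient | apply represents_partial].
  - intros u Hu k. rewrite lfield_scale_val by exact Hu. unfold tv_scale.
    rewrite lval_rat, Q2R_1, lpartial_val. ring.
Qed.

Lemma X1_represented : represents X1 lX1.
Proof. apply represents_sub; [apply represents_partial | exact Ef2_represented]. Qed.

#[local] Hint Rewrite lval_exp mult_IZR opp_IZR RtoC_opp : lval.

(** Corresponding exponents on the two sides are equal only up to a field identity;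
    they have to be made syntactically equal before [cexp] of them can be treated as
    an atom by [field]. *)
Ltac match_exponentials :=
  repeat match goal with
  | |- context [cexp ?v] =>
      match goal with
      | |- context [cexp ?w] =>
          assert_fails (constr_eq v w);
          replace (cexp v) with (cexp w) by (f_equal; field)
      end
  end.

Ltac exp_coefficient :=
  intros u Hu; pose proof (RtoC_y_neq u Hu); unfold sign_i; autorewrite with lval;
  match_exponentials; try field; auto.

Lemma X2_represented s : represents (X2 (IZR s * (3 * Ci))) (lX2 s).
Proof.
  apply represents_add; [apply represents_sub |]; apply represents_scale;
    try apply represents_partial; try exact Ef1_represented;
    try exact Ef3_represented; exp_coefficient.
Qed.

Lemma X3_represented : represents X3 lX3.
Proof.
  apply represents_add; [apply represents_add |]; apply represents_scale;
    try exact Ef1_represented; try exact Ef2_represented;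
    try exact Ef3_represented; coefficient.
Qed.

Lemma S1_represented s : represents (S1 (IZR s * Ci) (IZR s * (3 * Ci))) (lS1 s).
Proof.
  apply represents_add; apply represents_scale; try exact X1_represented; try apply X2_represented.
  all: exp_coefficient.
Qed.

Lemma S2_represented s : represents (S2 (IZR s * Ci) (IZR s * (3 * Ci))) (lS2 s).
Proof.
  apply represents_add; apply represents_scale; try exact X1_represented; try apply X2_represented.
  all: exp_coefficient.
Qed.

Lemma S3_represented s : represents (S3 (IZR s * Ci) (IZR s * (3 * Ci))) (lS3 s).
Proof.
  apply represents_add; [apply represents_add |]; apply represents_scale;
    try exact X1_represented; try apply X2_represented; try exact X3_represented.
  all: exp_coefficient.
Qed.

(** * The structure constants *)

(** The fields are numbered 0 to 13 in the order S1, ..., S6, h, H, L1, ..., L6.  With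
    h and H in place of A and B every element is an iterated bracket of the S's, and
    the structure constants are integers. *)
Definition lgenerated (S1 S2 S3 : lfield) : list lfield :=
  let S4 := lbracket S1 S2 in
  let S5 := lbracket S2 S3 in
  let S6 := lbracket S3 S1 in
  let L1 := lbracket S1 S4 in
  let L2 := lbracket S2 S4 in
  let L3 := lbracket S2 S5 in
  let L4 := lbracket S3 S5 in
  let L5 := lbracket S3 S6 in
  let L6 := lbracket S1 S6 in
  let H := lbracket S2 S6 in
  let h := lbracket S4 S3 in
  [S1; S2; S3; S4; S5; S6; h; H; L1; L2; L3; L4; L5; L6].

Definition generated (S1 S2 S3 : vf) : list vf :=
  let S4 := bracket S1 S2 in
  let S5 := bracket S2 S3 in
  let S6 := bracket S3 S1 in
  [S1; S2; S3; S4; S5; S6; bracket S4 S3; bracket S2 S6;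
   bracket S1 S4; bracket S2 S4; bracket S2 S5;
   bracket S3 S5; bracket S3 S6; bracket S1 S6].

Lemma represents_generated S1 S2 S3 F1 F2 F3 :
  represents S1 F1 -> represents S2 F2 -> represents S3 F3 ->
  Forall2 vf_eq (generated S1 S2 S3) (map lfield_val (lgenerated F1 F2 F3)).
Proof.
  intros E1 E2 E3. unfold represents in *.
  assert (Hb : forall X Y F G, vf_eq X (lfield_val F) -> vf_eq Y (lfield_val G) ->
    vf_eq (bracket X Y) (lfield_val (lbracket F G))).
  { intros X Y F G EX EY.
    exact (vf_eq_trans _ _ _ (bracket_ext _ _ _ _ EX EY) (lbracket_val F G)). }
  repeat constructor; auto 10.
Qed.

Inductive structure_entry := Entry (i j k : nat) (n : Z).

(** An entry [Entry i j k n], where i < j, says that the bracket of the fields number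
    i and j has coefficient n on the field number k; coefficients without an entry
    vanish.  The same numbers are obtained from the matrices of the octonion
    derivations that [oct_derivation] assigns to S1, S2 and S3. *)
Definition structure_table : list structure_entry :=
  [Entry 0 1 3 1; Entry 0 2 5 (-1); Entry 0 3 8 1; Entry 0 4 6 1; Entry 0 4 7 (-1);
   Entry 0 5 13 1; Entry 0 6 0 (-2); Entry 0 7 0 2; Entry 0 10 1 (-6); Entry 0 11 2 (-6);
   Entry 1 2 4 1; Entry 1 3 9 1; Entry 1 4 10 1; Entry 1 5 7 1; Entry 1 6 1 (-2);
   Entry 1 7 1 (-4); Entry 1 12 2 (-6); Entry 1 13 0 (-6);
   Entry 2 3 6 (-1); Entry 2 4 11 1; Entry 2 5 12 1; Entry 2 6 2 4; Entry 2 7 2 2;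
   Entry 2 8 0 (-6); Entry 2 9 1 (-6);
   Entry 3 4 1 (-8); Entry 3 5 0 8; Entry 3 6 3 (-4); Entry 3 7 3 (-2); Entry 3 11 4 6;
   Entry 3 12 5 6;
   Entry 4 5 2 (-8); Entry 4 6 4 2; Entry 4 7 4 (-2); Entry 4 8 3 6; Entry 4 13 5 6;
   Entry 5 6 5 2; Entry 5 7 5 4; Entry 5 9 3 6; Entry 5 10 4 6;
   Entry 6 8 8 6; Entry 6 9 9 6; Entry 6 11 11 (-6); Entry 6 12 12 (-6);
   Entry 7 9 9 6; Entry 7 10 10 6; Entry 7 12 12 (-6); Entry 7 13 13 (-6);
   Entry 8 10 9 (-6); Entry 8 11 6 12; Entry 8 11 7 (-6); Entry 8 12 13 6;
   Entry 9 11 10 6; Entry 9 12 6 6; Entry 9 12 7 6; Entry 9 13 8 (-6);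
   Entry 10 12 11 (-6); Entry 10 13 6 (-6); Entry 10 13 7 12;
   Entry 11 13 12 6].

Definition structure_constant (i j k : nat) : Z :=
  fold_right (fun '(Entry i' j' k' n) t =>
    if (Nat.eqb i i' && Nat.eqb j j' && Nat.eqb k k')%bool then n
    else if (Nat.eqb i j' && Nat.eqb j i' && Nat.eqb k k')%bool then (- n)%Z
    else t) 0%Z structure_table.

(** One half of the brackets suffices, by antisymmetry. *)
Definition structure_table_holds (l : list lfield) : bool :=
  forallb (fun i => forallb (fun j =>
      lfield_is_zero (lfield_add (lbracket (nth i l lfield_zero) (nth j l lfield_zero))
        (llincomb (fun k => (- structure_constant i j k)%Z) l)))
      (seq (S i) (13 - i))) (seq 0 14).

(** The bilinear bracket on R^14 with these structure constants. *)
Definition structure_bracket (c d : nat -> R) (k : nat) : R :=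
  rsum 14 (fun i => (c i * rsum 14 (fun j => d j * IZR (structure_constant i j k)))%R).

Definition has_structure (l : list vf) : Prop :=
  length l = 14%nat /\ Forall smooth l /\
  forall i j, (i < 14)%nat -> (j < 14)%nat ->
    vf_eq (bracket (nth i l vf_zero) (nth j l vf_zero))
      (lincomb (fun k => IZR (structure_constant i j k)) l).

(** So [fun c => lincomb c l] carries [structure_bracket] to the bracket of fields. *)
Lemma bracket_lincomb l c d :
  has_structure l ->
  vf_eq (bracket (lincomb c l) (lincomb d l)) (lincomb (structure_bracket c d) l).
Proof.
  intros [Hn [Hs Hb]] u Hu k.
  rewrite (bracket_lincomb_l c l _ Hs u Hu k).
  rewrite (lincomb_lincomb l _ (fun i n =>
    rsum 14 (fun j => d j * IZR (structure_constant i j n)))%R).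
  - now rewrite length_map, Hn.
  - intros i Hi. rewrite length_map in Hi. rewrite nth_map_vf by exact Hi.
    rewrite (bracket_lincomb_r _ d l Hs u Hu k).
    rewrite (lincomb_lincomb l _ (fun j n => IZR (structure_constant i j n))).
    + now rewrite length_map, Hn.
    + intros j Hj. rewrite length_map in Hj. rewrite nth_map_vf by exact Hj.
      apply Hb; [lia | lia | exact Hu].
Qed.

Lemma structure_constant_antisym i j k :
  (i < 14)%nat -> (j < 14)%nat -> (k < 14)%nat ->
  structure_constant j i k = (- structure_constant i j k)%Z.
Proof.
  intros Hi Hj Hk.
  assert (E : forallb (fun i => forallb (fun j => forallb (fun k =>
    Z.eqb (structure_constant j i k) (- structure_constant i j k))
      (seq 0 14)) (seq 0 14)) (seq 0 14) = true) by (vm_compute; reflexivity).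
  rewrite forallb_forall in E. specialize (E i ltac:(apply in_seq; lia)).
  rewrite forallb_forall in E. specialize (E j ltac:(apply in_seq; lia)).
  rewrite forallb_forall in E. specialize (E k ltac:(apply in_seq; lia)).
  now apply Z.eqb_eq.
Qed.

Lemma structure_table_holds_sound l :
  length l = 14%nat -> structure_table_holds l = true -> has_structure (map lfield_val l).
Proof.
  intros Hn Ht. split; [now rewrite length_map |]. split.
  { apply Forall_map, Forall_forall. intros F _. apply lfield_smooth. }
  assert (Hlt : forall i j, (i < j)%nat -> (j < 14)%nat ->
    vf_eq (bracket (nth i (map lfield_val l) vf_zero) (nth j (map lfield_val l) vf_zero))
      (lincomb (fun k => IZR (structure_constant i j k)) (map lfield_val l))).
  { intros i j Hij Hj u Hu k.
    rewrite !(fun i H => nth_indep (map lfield_val l) vf_zero (lfield_val lfield_zero) (n := i) H)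
      by (rewrite length_map; lia).
    rewrite !map_nth.
    unfold structure_table_holds in Ht. rewrite forallb_forall in Ht.
    specialize (Ht i ltac:(apply in_seq; lia)).
    rewrite forallb_forall in Ht. specialize (Ht j ltac:(apply in_seq; lia)).
    apply (lfield_is_zero_val _ u k) in Ht.
    rewrite lfield_add_val in Ht. unfold tv_add in Ht.
    rewrite llincomb_val, <- lbracket_val in Ht by exact Hu.
    rewrite (lincomb_ext _ (fun k => (-1) * IZR (structure_constant i j k))%R) in Ht
      by (intros; rewrite opp_IZR; ring).
    rewrite lincomb_scale in Ht.
    change (-1)%R with (- (1))%R in Ht. rewrite RtoC_opp in Ht.
    set (b := bracket _ _ u k) in *. set (v := lincomb _ _ u k) in *.
    replace b with (b + - (1) * v + v) by ring. rewrite Ht. ring. }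
  intros i j Hi Hj u Hu k.
  destruct (Nat.lt_trichotomy i j) as [H | [<- | H]].
  - now apply Hlt.
  - rewrite (lincomb_ext _ (fun _ => 0%R)).
    + rewrite lincomb_zero. unfold bracket, sum_coord. ring.
    + rewrite length_map, Hn. intros n Hk.
      pose proof (structure_constant_antisym i i n Hi Hi Hk).
      replace (structure_constant i i n) with 0%Z by lia. reflexivity.
  - rewrite bracket_antisym by exact Hu. unfold vf_scale, tv_scale.
    rewrite (Hlt j i H Hi u Hu k), <- lincomb_scale.
    erewrite lincomb_ext; [reflexivity |].
    rewrite length_map, Hn. intros n Hk.
    rewrite (structure_constant_antisym j i n), opp_IZR by assumption. ring.
Qed.

(** The computation behind the theorem: 91 brackets for each sign. *)
Lemma generators_structure s :
  s = 1%Z \/ s = (-1)%Z ->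
  has_structure (map lfield_val (lgenerated (lS1 s) (lS2 s) (lS3 s))).
Proof.
  intros Hs. apply structure_table_holds_sound; [reflexivity |].
  destruct Hs as [-> | ->]; vm_compute; reflexivity.
Qed.

(** * Linear independence *)

(** The two points (0, 1, 0, 0, 0) and (0, 1, 0, 0, 1).  With x = z = 0 all exponentials
    are 1, so the fields take Gaussian rational values there; together the values at
    the two points already separate the fourteen fields. *)
Definition base_point (t : bool) : point := fun k =>
  match k with cy => 1%R | cq => if t then 1%R else 0%R | _ => 0%R end.

(** Powers of y are 1 at the base points, and p = 0 kills every positive power of p. *)
Definition mono_survives (t : bool) (m : mono) : bool :=
  let '(Mono _ _ _ d e) := m in Nat.eqb d 0 && (t || Nat.eqb e 0).

Fixpoint value_at (t : bool) (P : laurent) : gauss :=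
  match P with
  | [] => (0, 0)%Q
  | (m, g) :: P' => if mono_survives t m then gadd g (value_at t P') else value_at t P'
  end.

Lemma space_base t : space (base_point t).
Proof. exact R1_neq_R0. Qed.

Lemma mono_val_base t m :
  mono_val m (base_point t) = if mono_survives t m then RtoC 1 else RtoC 0.
Proof.
  destruct m as [a b c d e].
  unfold mono_val, mono_abs, mono_arg, base_point, mono_survives.
  rewrite !Rmult_0_r, cos_0, sin_0, exp_0, powerRZ_R1, Rmult_0_r, Rmult_1_r.
  destruct d; [| simpl; unfold RtoC; f_equal; ring].
  destruct t; simpl; [rewrite pow1; unfold RtoC; f_equal; ring |].
  destruct e; simpl; unfold RtoC; f_equal; ring.
Qed.

Lemma lval_base_point t P : lval P (base_point t) = gval (value_at t P).
Proof.
  induction P as [| [m g] P IH]; simpl.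
  - now rewrite gval_real, RMicromega.Q2R_0.
  - rewrite mono_val_base, IH. destruct (mono_survives t m).
    + rewrite gval_add. ring.
    + ring.
Qed.

Fixpoint glincomb (c : nat -> R) (l : list gauss) : R * R :=
  match l with
  | [] => (0, 0)%R
  | g :: l' => let '(a, b) := glincomb (fun i => c (S i)) l' in
      (c 0%nat * Q2R (fst g) + a, c 0%nat * Q2R (snd g) + b)%R
  end.

Lemma lincomb_base c l t k :
  lincomb c (map lfield_val l) (base_point t) k =
  glincomb c (map (fun F => value_at t (component F k)) l).
Proof.
  revert c; induction l as [| F l IH]; intros c; [reflexivity |].
  simpl. unfold vf_add, vf_scale, tv_add, tv_scale. rewrite IH.
  unfold lfield_val. rewrite lval_base_point. destruct glincomb as [a b].
  unfold gval, Cplus, Cmult, RtoC; cbn [fst snd]. f_equal; ring.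
Qed.

Definition evaluation_matrix (l : list lfield) : list (list gauss) :=
  map (fun '(t, k) => map (fun F => value_at t (component F k)) l)
    (list_prod [false; true] [cx; cy; cz; cp; cq]).

Lemma evaluation_matrix_kernel c l :
  vf_eq (lincomb c (map lfield_val l)) vf_zero ->
  Forall (fun row => glincomb c row = (0, 0)%R) (evaluation_matrix l).
Proof.
  intros Hc. apply Forall_map, Forall_forall. intros [t k] _.
  rewrite <- lincomb_base. apply Hc, space_base.
Qed.

(** The real and imaginary parts of five components at two points are twenty linear
    equations with rational coefficients in the fourteen unknowns, of rank 14. *)
Lemma generated_independent s :
  s = 1%Z \/ s = (-1)%Z ->
  lin_indep (map lfield_val (lgenerated (lS1 s) (lS2 s) (lS3 s))).
Proof.
  intros Hs c Hc%evaluation_matrix_kernel.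
  destruct Hs as [-> | ->]; revert Hc;
  match goal with |- Forall _ ?M -> _ =>
    let M' := eval vm_compute in M in
    replace M with M' by (vm_compute; reflexivity)
  end;
  rewrite !Forall_cons_iff; cbn [glincomb fst snd]; rewrite !Q2R_make;
  intros Hc; decompose [and] Hc; clear Hc;
  repeat match goal with H : (_, _) = (_, _) |- _ => injection H as ? ? end;
  intros i Hi; do 14 (destruct i as [| i]; [lra |]); simpl in Hi; lia.
Qed.

(** * Derivations of the split octonions *)

Local Open Scope R_scope.

Definition row_apply (T : vec3 * vec3 * vec3) (u : vec3) : vec3 :=
  let '(r1, r2, r3) := T in (dot r1 u, dot r2 u, dot r3 u).

Definition transpose (T : vec3 * vec3 * vec3) : vec3 * vec3 * vec3 :=
  let '((a, b, c), (d, e, f), (g, h, i)) := T in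
  ((a, d, g), (b, e, h), (c, f, i)).

(** With m and n in R^3 and T of trace 0 these are all derivations of the split
    octonions: T runs through sl_3, the derivations that kill both idempotents, while
    m and n are the off-diagonal components of the image of the idempotent (1, 0, 0, 0). *)
Definition sl3_derivation (m n : vec3) (T : vec3 * vec3 * vec3) : oct -> oct :=
  fun '(a, b, u, v) =>
  let t := dot u n + dot m v in
  (- t, t,
   plus (plus (scal (a - b) m) (row_apply T u)) (cross v n),
   minus (minus (scal (a - b) n) (row_apply (transpose T) v)) (cross m u)).

(** The identification with the vector fields: S1, S2, S3 correspond to m = e_1, e_2,
    e_3 with n = 0 and T = 0.  The other eleven basis elements are iterated brackets of
    these, which forces the remaining coefficients: S5, S6, S4 give n = -2 e_1, -2 e_2,
    -2 e_3, the long root vectors give 6 times the six off-diagonal matrix units, and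
    h, H give the diagonal matrices (2, 2, -4) and (-2, 4, -2). *)
Definition oct_derivation (c : nat -> R) : oct -> oct :=
  sl3_derivation (c 0%nat, c 1%nat, c 2%nat)
    (- 2 * c 4%nat, - 2 * c 5%nat, - 2 * c 3%nat)
    ((2 * c 6%nat - 2 * c 7%nat, 6 * c 13%nat, 6 * c 8%nat),
     (6 * c 10%nat, 2 * c 6%nat + 4 * c 7%nat, 6 * c 9%nat),
     (6 * c 11%nat, 6 * c 12%nat, - 4 * c 6%nat - 2 * c 7%nat)).

Definition oct_coord (s : oct) (i : nat) : R :=
  let '(a, b, (u1, u2, u3), (v1, v2, v3)) := s in
  nth i [a; b; u1; u2; u3; v1; v2; v3] 0.

(** In this order: the idempotents e and f, then u_1, u_2, u_3, then v_1, v_2, v_3. *)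
Definition oct_basis (i : nat) : oct :=
  let d j := if Nat.eqb i j then 1 else 0 in
  (d 0%nat, d 1%nat, (d 2%nat, d 3%nat, d 4%nat), (d 5%nat, d 6%nat, d 7%nat)).

Definition matrix_entry (D : oct -> oct) (i j : nat) : R := oct_coord (D (oct_basis j)) i.

(** Column 0 of the matrix of D, the image of e, contains m and n; the columns 2 to 4,
    the images of the u_i, contain T. *)
Definition derivation_coord (D : oct -> oct) (k : nat) : R :=
  nth k
    [matrix_entry D 2 0; matrix_entry D 3 0; matrix_entry D 4 0;
     - matrix_entry D 7 0 / 2; - matrix_entry D 5 0 / 2; - matrix_entry D 6 0 / 2;
     matrix_entry D 2 2 / 3 + matrix_entry D 3 3 / 6; (matrix_entry D 3 3 - matrix_entry D 2 2) / 6;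
     matrix_entry D 2 4 / 6; matrix_entry D 3 4 / 6; matrix_entry D 3 2 / 6;
     matrix_entry D 4 2 / 6; matrix_entry D 4 3 / 6; matrix_entry D 2 3 / 6] 0.

Ltac oct_compute :=
  cbv -[Rplus Rmult Ropp Rminus Rdiv Rinv IZR];
  repeat match goal with |- (_, _) = (_, _) => apply (f_equal2 pair) end.

Lemma oct_derivation_derivation c : derivation (oct_derivation c).
Proof.
  split; [| split].
  - intros [[[a b] [[u1 u2] u3]] [[v1 v2] v3]] [[[a' b'] [[u1' u2'] u3']] [[v1' v2'] v3']].
    oct_compute; ring.
  - intros r [[[a b] [[u1 u2] u3]] [[v1 v2] v3]]. oct_compute; ring.
  - intros [[[a b] [[u1 u2] u3]] [[v1 v2] v3]] [[[a' b'] [[u1' u2'] u3']] [[v1' v2'] v3']].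
    oct_compute; ring.
Qed.

Lemma derivation_coord_oct_derivation c k :
  (k < 14)%nat -> derivation_coord (oct_derivation c) k = c k.
Proof.
  intros Hk. do 14 (destruct k as [| k]; [oct_compute; field |]). lia.
Qed.

Lemma oct_decompose (s : oct) :
  let t i := scal (oct_coord s i) (oct_basis i) in
  s = plus (t 0%nat) (plus (t 1%nat) (plus (t 2%nat) (plus (t 3%nat)
       (plus (t 4%nat) (plus (t 5%nat) (plus (t 6%nat) (t 7%nat))))))).
Proof.
  destruct s as [[[a b] [[u1 u2] u3]] [[v1 v2] v3]]. oct_compute; ring.
Qed.

(** The u_i generate the octonions: their products are the v_i up to sign, and the
    products of u_1 with v_1 are the two idempotents. *)
Lemma derivation_ext D D' :
  derivation D -> derivation D' ->
  D (oct_basis 2) = D' (oct_basis 2) /\ D (oct_basis 3) = D' (oct_basis 3) /\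
    D (oct_basis 4) = D' (oct_basis 4) ->
  forall s, D s = D' s.
Proof.
  intros [Dp [Ds Dm]] [Dp' [Ds' Dm']] [E2 [E3 E4]].
  assert (Hmul : forall i j k, oct_mul (oct_basis i) (oct_basis j) = oct_basis k ->
    D (oct_basis i) = D' (oct_basis i) -> D (oct_basis j) = D' (oct_basis j) ->
    D (oct_basis k) = D' (oct_basis k)).
  { intros i j k <- Ei Ej. now rewrite Dm, Dm', Ei, Ej. }
  assert (E5 := Hmul 4%nat 3%nat 5%nat ltac:(oct_compute; ring) E4 E3).
  assert (E6 := Hmul 2%nat 4%nat 6%nat ltac:(oct_compute; ring) E2 E4).
  assert (E7 := Hmul 3%nat 2%nat 7%nat ltac:(oct_compute; ring) E3 E2).
  assert (E0 := Hmul 2%nat 5%nat 0%nat ltac:(oct_compute; ring) E2 E5).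
  assert (E1 := Hmul 5%nat 2%nat 1%nat ltac:(oct_compute; ring) E5 E2).
  intros s. rewrite (oct_decompose s). cbv zeta.
  rewrite !Dp, !Dp', !Ds, !Ds'. congruence.
Qed.

(** Differentiating e e = e shows that D e is off-diagonal, hence given by m and n.
    Then e u = u and u e = 0 determine D u from m, n and its own upper right part, which
    defines T; a triple product forces the trace of T to vanish.  By [derivation_ext]
    the images of u_1, u_2, u_3 determine D. *)
Lemma derivation_classification D :
  derivation D -> forall s, D s = oct_derivation (derivation_coord D) s.
Proof.
  intros HD. apply derivation_ext; [exact HD | apply oct_derivation_derivation |].
  assert (D0 : D zero = zero).
  { rewrite <- (scal_zero_l (zero : oct)) at 1. rewrite (proj1 (proj2 HD)).
    apply (scal_zero_l (D zero)). }
  assert (P : forall i j r, oct_mul (oct_basis i) (oct_basis j) = r ->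
    D r = plus (oct_mul (D (oct_basis i)) (oct_basis j))
               (oct_mul (oct_basis i) (D (oct_basis j)))).
  { intros i j r <-. apply HD. }
  (* e e = e, and e u = u, u e = 0 for the three vectors u *)
  assert (P00 := P 0%nat 0%nat (oct_basis 0) ltac:(oct_compute; ring)).
  assert (P02 := P 0%nat 2%nat (oct_basis 2) ltac:(oct_compute; ring)).
  assert (P03 := P 0%nat 3%nat (oct_basis 3) ltac:(oct_compute; ring)).
  assert (P04 := P 0%nat 4%nat (oct_basis 4) ltac:(oct_compute; ring)).
  assert (P20 := P 2%nat 0%nat zero ltac:(oct_compute; ring)).
  assert (P30 := P 3%nat 0%nat zero ltac:(oct_compute; ring)).
  assert (P40 := P 4%nat 0%nat zero ltac:(oct_compute; ring)).
  (* u_3 (u_2 u_1) = e makes the trace of T vanish *)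
  assert (P32 := P 3%nat 2%nat (oct_basis 7) ltac:(oct_compute; ring)).
  assert (P47 := P 4%nat 7%nat (oct_basis 0) ltac:(oct_compute; ring)).
  clear P. rewrite D0 in *.
  unfold derivation_coord, matrix_entry.
  destruct (D (oct_basis 0)) as [[[a0 b0] [[p01 p02] p03]] [[q01 q02] q03]].
  destruct (D (oct_basis 2)) as [[[a2 b2] [[p21 p22] p23]] [[q21 q22] q23]].
  destruct (D (oct_basis 3)) as [[[a3 b3] [[p31 p32] p33]] [[q31 q32] q33]].
  destruct (D (oct_basis 4)) as [[[a4 b4] [[p41 p42] p43]] [[q41 q42] q43]].
  destruct (D (oct_basis 7)) as [[[a7 b7] [[p71 p72] p73]] [[q71 q72] q73]].
  cbv -[Rplus Rmult Ropp Rminus Rdiv Rinv IZR]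
    in P00, P02, P20, P03, P30, P04, P40, P32, P47.
  repeat match goal with
  | H : (_, _) = (_, _) |- _ => injection H as ? ? ? ? ? ? ? ?
  end.
  split; [| split]; oct_compute; lra.
Qed.

(** The commutators of octonion derivations obey the same table as the brackets of
    vector fields.  This is where the algebra is recognised as split g2. *)
Lemma derivation_coord_bracket c d k :
  (k < 14)%nat ->
  derivation_coord (der_bracket (oct_derivation c) (oct_derivation d)) k =
  structure_bracket c d k.
Proof.
  intros Hk. do 14 (destruct k as [| k]; [oct_compute; field |]). lia.
Qed.

Lemma matrix_entry_add D D' i j :
  matrix_entry (der_add D D') i j = matrix_entry D i j + matrix_entry D' i j.
Proof.
  unfold matrix_entry, der_add.
  destruct (D (oct_basis j)) as [[[a b] [[u1 u2] u3]] [[v1 v2] v3]].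
  destruct (D' (oct_basis j)) as [[[a' b'] [[u1' u2'] u3']] [[v1' v2'] v3']].
  do 8 (destruct i as [| i]; [reflexivity |]).
  destruct i; symmetry; apply Rplus_0_l.
Qed.

Lemma matrix_entry_scale r D i j :
  matrix_entry (der_scale r D) i j = r * matrix_entry D i j.
Proof.
  unfold matrix_entry, der_scale.
  destruct (D (oct_basis j)) as [[[a b] [[u1 u2] u3]] [[v1 v2] v3]].
  do 8 (destruct i as [| i]; [reflexivity |]).
  destruct i; symmetry; apply Rmult_0_r.
Qed.

Lemma derivation_coord_add D D' k :
  (k < 14)%nat ->
  derivation_coord (der_add D D') k = derivation_coord D k + derivation_coord D' k.
Proof.
  intros Hk. unfold derivation_coord. rewrite !matrix_entry_add.
  do 14 (destruct k as [| k]; [simpl nth; field |]). lia.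
Qed.

Lemma derivation_coord_scale r D k :
  (k < 14)%nat -> derivation_coord (der_scale r D) k = r * derivation_coord D k.
Proof.
  intros Hk. unfold derivation_coord. rewrite !matrix_entry_scale.
  do 14 (destruct k as [| k]; [simpl nth; field |]). lia.
Qed.

Lemma derivation_coord_ext D D' k :
  (forall s, D s = D' s) -> derivation_coord D k = derivation_coord D' k.
Proof. intros E. unfold derivation_coord, matrix_entry. now rewrite !E. Qed.

Lemma oct_derivation_zero c s :
  (forall k, (k < 14)%nat -> c k = 0) -> oct_derivation c s = zero.
Proof.
  intros Hc. unfold oct_derivation. rewrite !Hc by lia.
  destruct s as [[[a b] [[u1 u2] u3]] [[v1 v2] v3]]. oct_compute; ring.
Qed.

(** * The real span as a split form of g2 *)

Definition spanned_by (l : list vf) (g : vf -> Prop) : Prop :=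
  forall X, g X <-> exists c, vf_eq X (lincomb c l).

Lemma spanned_bracket_closed l g :
  has_structure l -> spanned_by l g -> bracket_closed g.
Proof.
  intros Hl Hg X Y [c Ec]%Hg [d Ed]%Hg. apply Hg.
  exists (structure_bracket c d).
  exact (vf_eq_trans _ _ _ (bracket_ext _ _ _ _ Ec Ed) (bracket_lincomb l c d Hl)).
Qed.

(** Coordinates of a derivation, read as coefficients of vector fields, give the
    isomorphism: brackets match by [derivation_coord_bracket], injectivity is linear
    independence, and surjectivity holds since every coordinate vector comes from a
    derivation. *)
Lemma spanned_split_g2 l g :
  has_structure l -> lin_indep l -> spanned_by l g -> isomorphic_to_split_g2 g.
Proof.
  intros Hl Hi Hg. pose proof (proj1 Hl) as Hn.
  exists (fun D => lincomb (derivation_coord D) l).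
  repeat split.
  - intros D _. apply Hg. eexists. apply vf_eq_refl.
  - intros D D' _ _ u _ k.
    rewrite (lincomb_ext _ (fun i => derivation_coord D i + derivation_coord D' i)).
    + apply lincomb_add.
    + intros i Hik. apply derivation_coord_add. lia.
  - intros r D _ u _ k.
    rewrite (lincomb_ext _ (fun i => r * derivation_coord D i)).
    + apply lincomb_scale.
    + intros i Hik. apply derivation_coord_scale. lia.
  - intros D D' HD HD'.
    apply (fun E => vf_eq_trans _ _ _ E (vf_eq_sym _ _ (bracket_lincomb l _ _ Hl))).
    erewrite lincomb_ext; [apply vf_eq_refl |]. intros i Hik.
    rewrite <- derivation_coord_bracket by lia. apply derivation_coord_ext.
    intros s. unfold der_bracket.
    now rewrite <- !(derivation_classification D HD), <- !(derivation_classification D' HD').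
  - intros D HD H0 s. rewrite (derivation_classification D HD).
    apply oct_derivation_zero. intros k Hk. apply (Hi _ H0). lia.
  - intros X [c Ec]%Hg. exists (oct_derivation c).
    split; [apply oct_derivation_derivation |].
    erewrite lincomb_ext; [exact (vf_eq_sym _ _ Ec) |].
    intros i Hik. apply derivation_coord_oct_derivation. lia.
Qed.

(** * Cartan subalgebra and roots *)

(** The roots, in the numbering of [lgenerated]. *)
Definition weight_A (k : nat) : R :=
  nth k [1; - 1 / 2; - 1 / 2; 1 / 2; -1; 1 / 2; 0; 0; 3 / 2; 0; - 3 / 2; - 3 / 2; 0; 3 / 2] 0.

Definition weight_B (k : nat) : R :=
  nth k [0; sqrt 3 / 2; - sqrt 3 / 2; sqrt 3 / 2; 0; - sqrt 3 / 2; 0; 0;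
         sqrt 3 / 2; sqrt 3; sqrt 3 / 2; - sqrt 3 / 2; - sqrt 3; - sqrt 3 / 2] 0.

(** Coefficients of A = (h - H) / 4 and B = (sqrt 3 / 12) (h + H). *)
Definition coord_A (k : nat) : R := nth k [0; 0; 0; 0; 0; 0; 1 / 4; - (1 / 4)] 0.

Definition coord_B (k : nat) : R := nth k [0; 0; 0; 0; 0; 0; sqrt 3 / 12; sqrt 3 / 12] 0.

Lemma structure_bracket_A c k :
  (k < 14)%nat -> structure_bracket coord_A c k = weight_A k * c k.
Proof.
  intros Hk. do 14 (destruct k as [| k];
  [cbv -[Rplus Rmult Ropp Rminus Rdiv Rinv IZR sqrt]; field |]). lia.
Qed.

Lemma structure_bracket_B c k :
  (k < 14)%nat -> structure_bracket coord_B c k = weight_B k * c k.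
Proof.
  intros Hk. do 14 (destruct k as [| k];
  [cbv -[Rplus Rmult Ropp Rminus Rdiv Rinv IZR sqrt]; field |]). lia.
Qed.

Definition on_cartan (c : nat -> R) : Prop :=
  forall k, (k < 14)%nat -> (k <> 6)%nat -> (k <> 7)%nat -> c k = 0.

(** Every root is nonzero, so the Cartan subalgebra is its own centraliser. *)
Lemma weights_separate k :
  (k < 14)%nat -> (k <> 6)%nat -> (k <> 7)%nat -> weight_A k <> 0 \/ weight_B k <> 0.
Proof.
  intros Hk H6 H7. assert (0 < sqrt 3) by (apply sqrt_lt_R0; lra).
  do 14 (destruct k as [| k];
    [unfold weight_A, weight_B; simpl nth; first [lia | left; lra | right; lra] |]). lia.
Qed.

Lemma structure_bracket_cartan c d k :
  on_cartan c -> on_cartan d -> (k < 14)%nat -> structure_bracket c d k = 0.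
Proof.
  intros Hc Hd Hk. unfold structure_bracket, rsum.
  repeat match goal with
  | |- context [c ?i] => rewrite (Hc i) by lia
  | |- context [d ?i] => rewrite (Hd i) by lia
  end.
  do 14 (destruct k as [| k];
  [cbv -[Rplus Rmult Ropp Rminus Rdiv Rinv IZR]; ring |]). lia.
Qed.

(** The subalgebra is abelian, hence nilpotent.  If X normalises it, then the bracket of
    A or B with X lies in it as well as in the sum of the root spaces, so each root
    component of X is killed by both coordinates of its root. *)
Lemma spanned_cartan l g h A B :
  has_structure l -> lin_indep l -> spanned_by l g ->
  (forall X, h X <-> exists c, on_cartan c /\ vf_eq X (lincomb c l)) ->
  vf_eq A (lincomb coord_A l) -> vf_eq B (lincomb coord_B l) ->
  cartan_subalgebra h g.
Proof.
  intros Hl Hi Hg Hh EA EB. pose proof (proj1 Hl) as Hn.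
  assert (H0 : forall X Y, h X -> h Y -> vf_eq (bracket X Y) vf_zero).
  { intros X Y [c [Hc Ec]]%Hh [d [Hd Ed]]%Hh.
    apply (vf_eq_trans _ _ _ (bracket_ext _ _ _ _ Ec Ed)).
    apply (vf_eq_trans _ _ _ (bracket_lincomb l c d Hl)).
    apply (vf_eq_trans _ (lincomb (fun _ => 0) l)).
    - apply vf_eq_lincomb. rewrite Hn. intros k Hk.
      now apply structure_bracket_cartan.
    - intros u _ k. apply lincomb_zero. }
  split; [| split; [| split]].
  - intros X [c [_ Ec]]%Hh. apply Hg. now exists c.
  - intros X Y HX HY. apply Hh. exists (fun _ => 0). split; [easy |].
    apply (vf_eq_trans _ _ _ (H0 X Y HX HY)). intros u _ k.
    now rewrite lincomb_zero.
  - exists 1%nat. intros X HX. simpl in HX.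
    induction HX as [X [Y [Z [HY [HZ ->]]]] | | X Y _ EX _ EY | r X _ EX | X Y E _ EX].
    + now apply H0.
    + apply vf_eq_refl.
    + intros u Hu k. unfold vf_add, tv_add. rewrite EX, EY by exact Hu.
      unfold vf_zero. ring.
    + intros u Hu k. unfold vf_scale, tv_scale. rewrite EX by exact Hu.
      unfold vf_zero. ring.
    + exact (vf_eq_trans _ _ _ (vf_eq_sym _ _ E) EX).
  - intros X [c Ec]%Hg HX. apply Hh. exists c. split; [| exact Ec].
    assert (HT : forall T t w, on_cartan t -> vf_eq T (lincomb t l) ->
      (forall k, (k < 14)%nat -> structure_bracket t c k = w k * c k) ->
      on_cartan (fun k => w k * c k)).
    { intros T t w Ht ET Hw k Hk H6 H7.
      assert (h T) as HhT by (apply Hh; now exists t).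
      apply HX, Hh in HhT. destruct HhT as [d [Hd Ed]].
      enough (E : w k * c k = -1 * d k) by (rewrite E, Hd by assumption; ring).
      revert k Hk H6 H7.
      enough (E : forall k, (k < length l)%nat -> w k * c k = -1 * d k)
        by (rewrite Hn in E; auto).
      apply lin_indep_inj; [exact Hi |].
      apply (vf_eq_trans _ (bracket T X)).
      - apply vf_eq_sym.
        apply (vf_eq_trans _ _ _ (bracket_ext _ _ _ _ ET Ec)).
        apply (vf_eq_trans _ _ _ (bracket_lincomb l _ _ Hl)).
        apply vf_eq_lincomb. now rewrite Hn.
      - intros u Hu k. rewrite lincomb_scale, <- (Ed u Hu k).
        now apply bracket_antisym. }
    intros k Hk H6 H7.
    assert (KA : weight_A k * c k = 0).
    { apply (HT A coord_A weight_A); try assumption.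
      - intros i Hik H6' H7'. do 14 (destruct i as [| i]; [try lia; reflexivity |]). lia.
      - intros i Hik. now apply structure_bracket_A. }
    assert (KB : weight_B k * c k = 0).
    { apply (HT B coord_B weight_B); try assumption.
      - intros i Hik H6' H7'. do 14 (destruct i as [| i]; [try lia; reflexivity |]). lia.
      - intros i Hik. now apply structure_bracket_B. }
    destruct (weights_separate k Hk H6 H7) as [W | W].
    + destruct (Rmult_integral _ _ KA); tauto.
    + destruct (Rmult_integral _ _ KB); tauto.
Qed.

Lemma weight_root_vector l A B V i :
  has_structure l ->
  vf_eq A (lincomb coord_A l) -> vf_eq B (lincomb coord_B l) ->
  (i < 14)%nat -> vf_eq V (nth i l vf_zero) ->
  root_vector A B V (weight_A i) (weight_B i).
Proof.
  intros Hl EA EB Hi EV. pose proof (proj1 Hl) as Hn.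
  assert (HT : forall T t w, vf_eq T (lincomb t l) ->
    (forall c k, (k < 14)%nat -> structure_bracket t c k = w k * c k) ->
    vf_eq (bracket T V) (vf_scale (w i) V)).
  { intros T t w ET Hw u Hu k.
    assert (EV' : vf_eq V (lincomb (unit_vector i) l)).
    { intros v Hv k'. rewrite lincomb_unit by lia. now apply EV. }
    rewrite (bracket_ext _ _ _ _ ET EV' u Hu k).
    rewrite (bracket_lincomb l _ _ Hl u Hu k).
    rewrite (lincomb_ext _ (fun k => w i * unit_vector i k)).
    - rewrite lincomb_scale. unfold vf_scale, tv_scale. now rewrite EV'.
    - rewrite Hn. intros j Hj. rewrite Hw by exact Hj.
      unfold unit_vector. destruct (Nat.eqb_spec j i) as [-> | _]; ring. }
  split.
  - apply (HT A coord_A); [exact EA | exact structure_bracket_A].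
  - apply (HT B coord_B); [exact EB | exact structure_bracket_B].
Qed.

(** * Pairwise bracket-generation *)

Definition g2_basis (S1 S2 S3 : vf) : list vf :=
  let S4 := bracket S1 S2 in
  let S5 := bracket S2 S3 in
  let S6 := bracket S3 S1 in
  let H := bracket S2 S6 in
  let h := bracket S4 S3 in
  [S1; S2; S3; S4; S5; S6;
   vf_scale (1 / 4) (vf_sub h H); vf_scale (sqrt 3 / 12) (vf_add h H);
   bracket S1 S4; bracket S2 S4; bracket S2 S5; bracket S3 S5; bracket S3 S6; bracket S1 S6].

(** Passage from coefficients with respect to A and B to coefficients with respect to
    h and H, and back. *)
Definition to_generated (c : nat -> R) (k : nat) : R :=
  match k with
  | 6%nat => 1 / 4 * c 6%nat + sqrt 3 / 12 * c 7%nat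
  | 7%nat => - (1 / 4 * c 6%nat) + sqrt 3 / 12 * c 7%nat
  | _ => c k
  end.

Definition of_generated (c : nat -> R) (k : nat) : R :=
  match k with
  | 6%nat => 2 * (c 6%nat - c 7%nat)
  | 7%nat => 2 * sqrt 3 * (c 6%nat + c 7%nat)
  | _ => c k
  end.

Lemma sqrt_3_sqr : sqrt 3 * sqrt 3 = 3.
Proof. apply sqrt_sqrt. lra. Qed.

Lemma to_of_generated c k : to_generated (of_generated c) k = c k.
Proof.
  pose proof sqrt_3_sqr as H.
  do 8 (destruct k as [| k]; [simpl; try reflexivity; field [H] |]). reflexivity.
Qed.

Lemma of_to_generated c k : of_generated (to_generated c) k = c k.
Proof.
  pose proof sqrt_3_sqr as H.
  do 8 (destruct k as [| k]; [simpl; try reflexivity; field [H] |]). reflexivity.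
Qed.

Lemma lincomb_g2_basis c S1 S2 S3 u k :
  lincomb c (g2_basis S1 S2 S3) u k =
  lincomb (to_generated c) (generated S1 S2 S3) u k.
Proof.
  unfold g2_basis, generated. cbv zeta.
  cbn [lincomb to_generated].
  unfold vf_add, vf_sub, vf_scale, tv_add, tv_scale, vf_zero.
  rewrite !RtoC_plus, RtoC_opp, !RtoC_mult. ring.
Qed.

Lemma pairwise_bracket_generate_of_structure S1 S2 S3 l :
  Forall2 vf_eq (generated S1 S2 S3) l -> has_structure l -> lin_indep l ->
  pairwise_bracket_generate S1 S2 S3.
Proof.
  intros El Hl Hi. pose proof (proj1 Hl) as Hn.
  assert (Eb : forall c, vf_eq (lincomb c (g2_basis S1 S2 S3)) (lincomb (to_generated c) l)).
  { intros c u Hu k. rewrite lincomb_g2_basis. now apply lincomb_Forall2. }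
  assert (Hg : spanned_by l (span_list (g2_basis S1 S2 S3))).
  { intros X. rewrite span_list_lincomb. split; intros [c Ec].
    - exists (to_generated c). exact (vf_eq_trans _ _ _ Ec (Eb c)).
    - exists (of_generated c). apply (vf_eq_trans _ _ _ Ec), vf_eq_sym.
      apply (vf_eq_trans _ _ _ (Eb _)), vf_eq_lincomb.
      intros i _. apply to_of_generated. }
  unfold pairwise_bracket_generate. cbv zeta.
  set (A := vf_scale (1 / 4) _). set (B := vf_scale (sqrt 3 / 12) _).
  assert (EA : vf_eq A (lincomb coord_A l)).
  { intros u Hu k. rewrite <- (lincomb_Forall2 coord_A _ _ El u Hu k).
    unfold A, vf_scale, vf_sub, tv_scale, tv_add. simpl.
    unfold vf_add, vf_scale, tv_add, tv_scale, vf_zero, coord_A; simpl nth.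
    rewrite RtoC_opp. ring. }
  assert (EB : vf_eq B (lincomb coord_B l)).
  { intros u Hu k. rewrite <- (lincomb_Forall2 coord_B _ _ El u Hu k).
    unfold B, vf_scale, vf_add, tv_scale, tv_add. simpl.
    unfold vf_add, vf_scale, tv_add, tv_scale, vf_zero, coord_B; simpl nth. ring. }
  split; [| split; [| split; [| split]]].
  - intros c Hc i Hik.
    rewrite <- (of_to_generated c i).
    assert (Z : forall j, (j < 14)%nat -> to_generated c j = 0).
    { rewrite <- Hn. apply Hi. exact (vf_eq_trans _ _ _ (vf_eq_sym _ _ (Eb c)) Hc). }
    unfold of_generated. rewrite !Z by (simpl in Hik; lia).
    do 8 (destruct i as [| i]; [ring |]). reflexivity.
  - exact (spanned_bracket_closed l _ Hl Hg).
  - exact (spanned_split_g2 l _ Hl Hi Hg).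
  - apply (spanned_cartan l _ _ A B Hl Hi Hg); [| exact EA | exact EB].
    intros X. rewrite span_list_lincomb.
    assert (EAB : forall c, vf_eq (lincomb c [A; B])
      (lincomb (fun k => c 0%nat * coord_A k + c 1%nat * coord_B k) l)).
    { intros c u Hu k. rewrite lincomb_add, !lincomb_scale, <- EA, <- EB by exact Hu.
      simpl. unfold vf_add, vf_scale, tv_add, tv_scale, vf_zero. ring. }
    split.
    + intros [c Ec]. eexists. split; [| exact (vf_eq_trans _ _ _ Ec (EAB c))].
      intros k Hk H6 H7.
      do 14 (destruct k as [| k]; [try lia; unfold coord_A, coord_B; simpl nth; ring |]). lia.
    + intros [c [Hc Ec]].
      (* A and B are the elements number 6 and 7 of [g2_basis] *)
      exists (fun i => of_generated c (6 + i)).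
      apply (vf_eq_trans _ _ _ Ec), vf_eq_sym, (vf_eq_trans _ _ _ (EAB _)), vf_eq_lincomb.
      rewrite Hn. intros k Hk. pose proof sqrt_3_sqr as H.
      do 14 (destruct k as [| k]; [unfold coord_A, coord_B; simpl;
         first [rewrite (Hc _ Hk) by lia; ring | field [H]] |]). lia.
  - assert (W : forall i, (i < 14)%nat ->
      root_vector A B (nth i (generated S1 S2 S3) vf_zero) (weight_A i) (weight_B i)).
    { intros i Hik. apply (weight_root_vector l); try assumption.
      now apply nth_Forall2. }
    (* short and long roots, in the numbering of [lgenerated] *)
    split.
    + refine (conj (W 0%nat _) (conj (W 4%nat _) (conj (W 3%nat _)
        (conj (W 2%nat _) (conj (W 1%nat _) (W 5%nat _)))))); lia.
    + refine (conj (W 8%nat _) (conj (W 11%nat _) (conj (W 9%nat _)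
        (conj (W 12%nat _) (conj (W 10%nat _) (W 13%nat _)))))); lia.
Qed.

Theorem theorem4p2 (sgn : R) (alpha : C)
  (Hsgn : sgn = 1%R \/ sgn = (-1)%R)
  (Halpha : alpha = (sgn * (3 * Ci))%C) :
  pairwise_bracket_generate
    (S1 (sgn * Ci)%C alpha) (S2 (sgn * Ci)%C alpha) (S3 (sgn * Ci)%C alpha).
Proof.
  assert (Hs : exists s, (s = 1%Z \/ s = (-1)%Z) /\ sgn = IZR s)
    by (destruct Hsgn; [exists 1%Z | exists (-1)%Z]; tauto).
  destruct Hs as [s [Hs ->]]. rewrite Halpha.
  apply (pairwise_bracket_generate_of_structure _ _ _
    (map lfield_val (lgenerated (lS1 s) (lS2 s) (lS3 s)))).
  - apply represents_generated;
      [apply S1_represented | apply S2_represented | apply S3_represented].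
  - now apply generators_structure.
  - now apply generated_independent.
Qed.
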